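(* Let $R=K\langle X_1,\dots,X_n\rangle$ be the free $K$-algebra on $n$ generators, $\mathcal{B}$ its standard $K$-basis (all words in the $X_i$, including $1$), and $X_{\ell_1},\dots,X_{\ell_n}$ a permutation of $X_1,\dots,X_n$. Suppose that, with respect to some two-sided monomial ordering $\prec$ on $\mathcal{B}$, $\mathcal{G}=\Omega\cup G$ is a minimal Gröbner basis of the ideal $I=\langle\mathcal{G}\rangle$, where $\Omega\subset\mathcal{B}$ and $G$ consists of $\frac{n(n-1)}{2}$ elements $g_{ji}$, $1\le i<j\le n$, with $\mathbf{LM}(g_{ji})=X_{\ell_j}X_{\ell_i}$. Let $A=R/I$. (i) If $g_{ji}=X_{\ell_j}X_{\ell_i}-\lambda_{ji}X_{\ell_i}X_{\ell_p}$ with $i<p\le n$ ($p$ may depend on $(j,i)$) and $\lambda_{ji}\in K^*\cup\{0\}$ for all $1\le i<j\le n$, then $\overline{X_{\ell_1}}^{\alpha_1}\cdots\overline{X_{\ell_n}}^{\alpha_n}\ne0$ implies $X_{\ell_1}^{\alpha_1}\cdots X_{\ell_n}^{\alpha_n}\in N(I)$, and consequently $A$ has a left Gröbner basis theory with respect to the left admissible system $(\overline{N(I)},\prec_I)$, where $\prec_I$ is induced by the lexicographic ordering or the $\mathbb{N}$-graded lexicographic ordering on $\mathbb{N}^n$ such that $\overline{X_{\ell_n}}\prec_I\cdots\prec_I\overline{X_{\ell_1}}$. (ii) If $g_{ji}=X_{\ell_j}X_{\ell_i}-\lambda_{ji}X_{\ell_p}X_{\ell_j}$ with $p<j$ ($p$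 may depend on $(j,i)$) and $\lambda_{ji}\in K^*\cup\{0\}$ for all $1\le i<j\le n$, then $\overline{X_{\ell_1}}^{\alpha_1}\cdots\overline{X_{\ell_n}}^{\alpha_n}\ne0$ implies $X_{\ell_1}^{\alpha_1}\cdots X_{\ell_n}^{\alpha_n}\in N(I)$, and consequently $A$ has a right Gröbner basis theory with respect to the right admissible system $(\overline{N(I)},\prec_I)$, where $\prec_I$ is induced by the $\mathbb{N}$-graded reverse lexicographic ordering on $\mathbb{N}^n$ such that $\overline{X_{\ell_n}}\prec_I\cdots\prec_I\overline{X_{\ell_1}}$. (iii) If $g_{ji}=X_{\ell_j}X_{\ell_i}-\lambda_{ji}X_{\ell_i}X_{\ell_j}$ with $\lambda_{ji}\in K^*\cup\{0\}$ for all $1\le i<j\le n$, then $\overline{X_{\ell_1}}^{\alpha_1}\cdots\overline{X_{\ell_n}}^{\alpha_n}\ne0$ implies $X_{\ell_1}^{\alpha_1}\cdots X_{\ell_n}^{\alpha_n}\in N(I)$, and consequently $A$ has a two-sided Gröbner basis theory with respect to the two-sided admissible system $(\overline{N(I)},\prec_I)$, where $\prec_I$ is induced by any one of the lexicographic, the $\mathbb{N}$-graded lexicographic, and the $\mathbb{N}$-graded reverse lexicographic orderings on $\mathbb{N}^n$ such that $\overline{X_{\ell_n}}\prec_I\cdots\prec_I\overline{X_{\ell_1}}$.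
   Context: $K$ is a field, $K^*=K\setminus\{0\}$, $\mathbb{N}$ is the set of nonnegative integers; a $K$-algebra is a finitely generated associative $K$-algebra with identity $1$; an ideal is a two-sided ideal; $\langle S\rangle$ is the two-sided ideal generated by $S$. A skew multiplicative $K$-basis of a $K$-algebra $\Lambda$ generated by $a_1,\dots,a_n$ is a $K$-basis $\mathcal{B}$ consisting of products of powers of the generators such that for all $u,v\in\mathcal{B}$ either $uv=0$ or $uv=\lambda w$ with $\lambda\in K^*$, $w\in\mathcal{B}$. Elements of $\mathcal{B}$ are called monomials. Given a well-ordering $\prec$ on $\mathcal{B}$ and $0\ne f=\sum_{i=1}^s\lambda_iu_i$ with $\lambda_i\in K^*$, $u_i\in\mathcal{B}$, $u_1\prec\cdots\prec u_s$, put $\mathbf{LM}(f)=u_s$; also $\mathbf{LM}(0)=0$. A well-ordering $\prec$ on $\mathcal{B}$ is a two-sided monomial ordering if: (MO1) whenever $w,u,v,s\in\mathcal{B}$, $w\prec u$ and $\mathbf{LM}(vws),\mathbf{LM}(vus)\notin K^*\cup\{0\}$, then $\mathbf{LM}(vws)\prec\mathbf{LM}(vus)$; (MO2) for $w,u\in\mathcal{B}$, if $u=\mathbf{LM}(vws)$ for some $v,s\in\mathcal{B}$ with $v\ne1$ or $s\ne1$ (in case $1\in\mathcal{B}$), then $w\prec u$. It is a left monomial ordering if: whenever $w,u,v\in\mathcal{B}$, $w\prec u$ and $\mathbf{LM}(vw),\mathbf{LM}(vu)\notin K^*\cup\{0\}$, then $\mathbf{LM}(vw)\prec\mathbf{LM}(vu)$;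 and for $w,u\in\mathcal{B}$, if $u=\mathbf{LM}(vw)$ for some $v\in\mathcal{B}$ with $v\ne1$ (in case $1\in\mathcal{B}$), then $w\prec u$. Right monomial orderings are defined symmetrically, with $vw,vu$ replaced by $wv,uv$. The pair $(\mathcal{B},\prec)$ is then a two-sided (left, right) admissible system, and an algebra with a skew multiplicative $K$-basis having a two-sided (left, right) admissible system is said to have a two-sided (left, right) Gröbner basis theory. For $u,v\in\mathcal{B}$, $u\mid v$ means $v=\lambda wus$ for some $w,s\in\mathcal{B}$, $\lambda\in K^*$. For an ideal $I$ of $R$, a subset $\mathcal{G}\subset I$ of nonzero elements is a Gröbner basis of $I$ if for each nonzero $f\in I$ there is $g\in\mathcal{G}$ with $\mathbf{LM}(g)\mid\mathbf{LM}(f)$; it is minimal if no proper subset is a Gröbner basis of $I$. $N(I)=\{u\in\mathcal{B}\mid\mathbf{LM}(f)\nmid u\text{ for all }0\ne f\in I\}$ is the set of normal monomials (in the present situation these are of the form $X_{\ell_1}^{\alpha_1}\cdots X_{\ell_n}^{\alpha_n}$). For $f\in R$, $\bar f=f+I$; $\overline{N(I)}=\{\bar u\mid u\in N(I)\}$. The ordering $\prec_I$ on $\overline{N(I)}$ induced by an ordering $<$ on $\mathbb{N}^n$: $\overline{X_{\ell_1}}^{\alpha_1}\cdots\overline{X_{\ell_n}}^{\alpha_n}\prec_I\overline{X_{\ell_1}}^{\beta_1}\cdots\overline{X_{\ell_n}}^{\beta_n}$ iff $\alpha<\beta$. With $|\alpha|=\alpha_1+\cdots+\alpha_n$: lexicographic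 (from the left): $\alpha<\beta$ iff $\alpha_i<\beta_i$ at the first index $i$ where they differ; $\mathbb{N}$-graded lexicographic: $|\alpha|<|\beta|$, or $|\alpha|=|\beta|$ and $\alpha$ is lexicographically smaller than $\beta$; $\mathbb{N}$-graded reverse lexicographic: $|\alpha|<|\beta|$, or $|\alpha|=|\beta|$ and $\alpha_i>\beta_i$ at the last index $i$ where they differ. *)

(* Defs.v *)
From HB Require Import structures.
From mathcomp Require Import all_boot all_algebra perm.
From mathcomp Require Import generic_quotient ring_quotient.
From mathcomp Require Import boolp classical_sets.
From mathcomp Require Import monalg.

Set Implicit Arguments.
Unset Strict Implicit.
Unset Printing Implicit Defensive.

Import GRing.Theory.

Local Open Scope classical_set_scope.
Local Open Scope quotient_scope.
Local Open Scope ring_scope.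

(* Associative unital K-algebras: rings A with a ring morphism from K to the
   center of A, and with scaling c *k: x. The zero algebra, which is not an
   [algType K], is allowed, so that R / I is an algebra also when I = R. *)
HB.mixin Record isPzAlgebra (K : pzRingType) A of GRing.PzRing A := {
  alg_scalar : K -> A;
  alg_scalar_zmod_morphism : zmod_morphism alg_scalar;
  alg_scalar_monoid_morphism : monoid_morphism alg_scalar;
  alg_scalarC : forall (c : K) (x : A), alg_scalar c * x = x * alg_scalar c
}.

#[short(type="pzAlgType")]
HB.structure Definition PzAlgebra (K : pzRingType) :=
  {A of GRing.PzRing A & isPzAlgebra K A}.

HB.instance Definition _ (K : pzRingType) (A : pzAlgType K) :=
  GRing.isZmodMorphism.Build K A (@alg_scalar K A)
    (@alg_scalar_zmod_morphism K A).
HB.instance Definition _ (K : pzRingType) (A : pzAlgType K) :=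
  GRing.isMonoidMorphism.Build K A (@alg_scalar K A)
    (@alg_scalar_monoid_morphism K A).

Definition alg_scale (K : pzRingType) (A : pzAlgType K) (c : K) (x : A) : A :=
  alg_scalar c * x.

Notation "c *k: x" := (alg_scale c x) (at level 40) : ring_scope.

(* Two-sided ideals, possibly not proper *)

HB.mixin Record isTwoSided (R : pzRingType) (S : R -> bool) := {
  two_sided_mull : forall a x : R, S x -> S (a * x);
  two_sided_mulr : forall x a : R, S x -> S (x * a)
}.

#[short(type="idealType")]
HB.structure Definition TwoSidedIdeal (R : pzRingType) :=
  {S of GRing.ZmodClosed R S & isTwoSided R S}.

Section GeneratedIdeal.
Variables (R : pzRingType) (S : set R).

Definition ideal_gen_pred : R -> bool :=
  fun x => `[< forall J : idealType R, (forall s, S s -> s \in J) -> x \in J >].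

Fact ideal_gen_zmod_closed : zmod_closed ideal_gen_pred.
Proof.
split=> [|x y /asboolP Ix /asboolP Iy]; apply/asboolP => J SJ.
  exact: rpred0.
by rewrite rpredB ?Ix ?Iy.
Qed.

HB.instance Definition _ :=
  GRing.isZmodClosed.Build R ideal_gen_pred ideal_gen_zmod_closed.

Fact ideal_gen_mull a x : ideal_gen_pred x -> ideal_gen_pred (a * x).
Proof.
by move=> /asboolP Ix; apply/asboolP => J SJ; apply/two_sided_mull/Ix.
Qed.

Fact ideal_gen_mulr x a : ideal_gen_pred x -> ideal_gen_pred (x * a).
Proof.
by move=> /asboolP Ix; apply/asboolP => J SJ; apply/two_sided_mulr/Ix.
Qed.

HB.instance Definition _ :=
  isTwoSided.Build R ideal_gen_pred ideal_gen_mull ideal_gen_mulr.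

Definition ideal_gen : idealType R := TwoSidedIdeal.clone R ideal_gen_pred _.

End GeneratedIdeal.

(* The quotient algebra R / I; [Quotient.quot] only provides the additive
   group when R is not commutative. *)
Section QuotientAlgebra.
Variables (K : pzRingType) (R : pzAlgType K) (I : idealType R).

Definition quot_alg := Quotient.quot I.

HB.instance Definition _ := GRing.Zmodule.on quot_alg.

Definition pi_alg (x : R) : quot_alg := \pi_(Quotient.quot I) x.

Lemma pi_algP x y : pi_alg x = pi_alg y <-> x - y \in I.
Proof.
rewrite Quotient.idealrBE; split; first by move=> e; apply/eqP.
by move/eqP.
Qed.

Lemma pi_algK x : pi_alg (repr x) = x.
Proof. exact: reprK. Qed.

Lemma pi_algD x y : pi_alg (x + y) = pi_alg x + pi_alg y.
Proof. exact: (raddfD (\pi_(Quotient.quot I))). Qed.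

Definition quot_one : quot_alg := pi_alg 1.
Definition quot_mul (x y : quot_alg) : quot_alg := pi_alg (repr x * repr y).
Definition quot_scalar (c : K) : quot_alg := pi_alg (alg_scalar c).

Lemma pi_algM x y : pi_alg (x * y) = quot_mul (pi_alg x) (pi_alg y).
Proof.
apply/pi_algP; set x' := repr _; set y' := repr _.
have Ix : x - x' \in I by apply/pi_algP; rewrite pi_algK.
have Iy : y - y' \in I by apply/pi_algP; rewrite pi_algK.
rewrite -(subrK (x' * y) (x * y)) -mulrBl -addrA -mulrBr rpredD //.
  exact: two_sided_mulr.
exact: two_sided_mull.
Qed.

Fact quot_mulA : associative quot_mul.
Proof.
move=> x y z; rewrite -[x]pi_algK -[y]pi_algK -[z]pi_algK.
by rewrite -!pi_algM mulrA.
Qed.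

Fact quot_mul1 : left_id quot_one quot_mul.
Proof. by move=> x; rewrite -[x]pi_algK -pi_algM mul1r. Qed.

Fact quot_mulr1 : right_id quot_one quot_mul.
Proof. by move=> x; rewrite -[x]pi_algK -pi_algM mulr1. Qed.

Fact quot_mulDl : left_distributive quot_mul +%R.
Proof.
move=> x y z; rewrite -[x]pi_algK -[y]pi_algK -[z]pi_algK.
by rewrite -pi_algD -!pi_algM -pi_algD mulrDl.
Qed.

Fact quot_mulDr : right_distributive quot_mul +%R.
Proof.
move=> x y z; rewrite -[x]pi_algK -[y]pi_algK -[z]pi_algK.
by rewrite -pi_algD -!pi_algM -pi_algD mulrDr.
Qed.

HB.instance Definition _ := GRing.Zmodule_isPzRing.Build quot_alg
  quot_mulA quot_mul1 quot_mulr1 quot_mulDl quot_mulDr.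

Fact pi_alg_is_zmod_morphism : zmod_morphism pi_alg.
Proof. exact: (raddfB (\pi_(Quotient.quot I))). Qed.

Fact pi_alg_is_monoid_morphism : monoid_morphism pi_alg.
Proof. by split=> // x y; exact: pi_algM. Qed.

HB.instance Definition _ :=
  GRing.isZmodMorphism.Build R quot_alg pi_alg pi_alg_is_zmod_morphism.
HB.instance Definition _ :=
  GRing.isMonoidMorphism.Build R quot_alg pi_alg pi_alg_is_monoid_morphism.

Fact quot_scalar_zmod_morphism : zmod_morphism quot_scalar.
Proof. by move=> c d; rewrite /quot_scalar !raddfB. Qed.

Fact quot_scalar_monoid_morphism : monoid_morphism quot_scalar.
Proof. by split=> [|c d]; rewrite /quot_scalar ?rmorph1 ?rmorphM. Qed.

Fact quot_scalarC c (x : quot_alg) : quot_scalar c * x = x * quot_scalar c.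
Proof. by rewrite -[x]pi_algK -!rmorphM alg_scalarC. Qed.

HB.instance Definition _ := isPzAlgebra.Build K quot_alg
  quot_scalar_zmod_morphism quot_scalar_monoid_morphism quot_scalarC.

End QuotientAlgebra.

(* The free algebra K<X_0, ..., X_(n-1)>, as the monoid algebra of the free
   monoid on 'I_n. *)
Section FreeAlgebra.
Variables (K : fieldType) (n : nat).

Definition free_alg := {malg K[{fmonom 'I_n}]}.

HB.instance Definition _ := GRing.NzRing.on free_alg.
HB.instance Definition _ := GRing.Lmodule.on free_alg.

Definition free_scalar (c : K) : free_alg := c%:MP.

Fact free_scalar_zmod_morphism : zmod_morphism free_scalar.
Proof. exact: (raddfB (@malgC {fmonom 'I_n} K)). Qed.

Fact free_scalar_monoid_morphism : monoid_morphism free_scalar.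
Proof.
by split; [exact: rmorph1 (@malgC _ _) | exact: rmorphM (@malgC _ _)].
Qed.

Fact free_scalarC c (x : free_alg) : free_scalar c * x = x * free_scalar c.
Proof.
rewrite !malgM_def fgmulUg fgmulgU; apply: eq_bigr => k _.
by rewrite mulrC mul1m mulm1.
Qed.

HB.instance Definition _ := isPzAlgebra.Build K free_alg
  free_scalar_zmod_morphism free_scalar_monoid_morphism free_scalarC.

Lemma free_alg_scaleE (c : K) (x : free_alg) : c *k: x = c *: x.
Proof. exact: mul_malgC. Qed.

Definition gen (i : 'I_n) : free_alg := << fmu i >>.

Definition words : set free_alg := range (fun m => << m >> : free_alg).

End FreeAlgebra.

Arguments gen K {n} i.
Arguments words K n : clear implicits.

Section Bases.
Variables (K : fieldType) (A : pzAlgType K).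
Implicit Types (B : set A) (prec : rel A).

Definition subalgebra (S : set A) : Prop :=
  [/\ S 1, (forall x y, S x -> S y -> S (x + y)),
      (forall (c : K) x, S x -> S (c *k: x)) &
      (forall x y, S x -> S y -> S (x * y))].

Definition alg_generated_by n (a : 'I_n -> A) : Prop :=
  forall S, subalgebra S -> (forall i, S (a i)) -> S = setT.

Definition lin_indep B : Prop :=
  forall (s : seq A) (c : A -> K), uniq s -> (forall u, u \in s -> B u) ->
    \sum_(u <- s) c u *k: u = 0 -> forall u, u \in s -> c u = 0.

Definition spanning B : Prop :=
  forall x : A, exists (s : seq A) (c : A -> K),
    (forall u, u \in s -> B u) /\ x = \sum_(u <- s) c u *k: u.

Definition is_basis B : Prop := lin_indep B /\ spanning B.

Definition skew_mult_basis n (a : 'I_n -> A) B : Prop :=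
  [/\ alg_generated_by a,
      is_basis B,
      (forall u, B u -> exists s : seq ('I_n * nat),
          u = \prod_(t <- s) a t.1 ^+ t.2) &
      (forall u v, B u -> B v ->
          u * v = 0 \/
          exists (c : K) (w : A), [/\ c != 0, B w & u * v = c *k: w])].

(* [prec] is the strict order; only its restriction to B matters. *)
Definition well_ordering B prec : Prop :=
  [/\ (forall u, B u -> ~~ prec u u),
      (forall u v w, B u -> B v -> B w -> prec u v -> prec v w -> prec u w),
      (forall u v, B u -> B v -> [\/ prec u v, u = v | prec v u]) &
      (forall S : set A, S `<=` B -> S !=set0 ->
          exists2 m, S m & forall u, S u -> u <> m -> prec m u)].

(* u is the last term u_s in an expression of f as a sum of terms
   lambda_i u_i with nonzero lambda_i and u_1 < ... < u_s in B. *)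
Definition leads B prec (f u : A) : Prop :=
  exists (s : seq A) (c : A -> K),
    [/\ (forall v, v \in rcons s u -> B v /\ c v != 0),
        sorted prec (rcons s u) &
        f = \sum_(v <- rcons s u) c v *k: v].

Definition LM B prec (f : A) : A :=
  if f == 0 then 0 else xget 0 [set u | leads B prec f u].

Definition is_scalar (x : A) : Prop := exists c : K, x = alg_scalar c.

(* In the second clause of each of the next three definitions, the condition
   v != 1 holds automatically when 1 is not in B. *)
Definition two_sided_monomial_ordering B prec : Prop :=
  [/\ well_ordering B prec,
      (forall w u v s, B w -> B u -> B v -> B s -> prec w u ->
          ~ is_scalar (LM B prec (v * w * s)) ->
          ~ is_scalar (LM B prec (v * u * s)) ->
          prec (LM B prec (v * w * s)) (LM B prec (v * u * s))) &
      (forall w u, B w -> B u ->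
          (exists v s, [/\ B v, B s, v != 1 \/ s != 1 &
                           u = LM B prec (v * w * s)]) ->
          prec w u)].

Definition left_monomial_ordering B prec : Prop :=
  [/\ well_ordering B prec,
      (forall w u v, B w -> B u -> B v -> prec w u ->
          ~ is_scalar (LM B prec (v * w)) ->
          ~ is_scalar (LM B prec (v * u)) ->
          prec (LM B prec (v * w)) (LM B prec (v * u))) &
      (forall w u, B w -> B u ->
          (exists v, [/\ B v, v != 1 & u = LM B prec (v * w)]) ->
          prec w u)].

Definition right_monomial_ordering B prec : Prop :=
  [/\ well_ordering B prec,
      (forall w u v, B w -> B u -> B v -> prec w u ->
          ~ is_scalar (LM B prec (w * v)) ->
          ~ is_scalar (LM B prec (u * v)) ->
          prec (LM B prec (w * v)) (LM B prec (u * v))) &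
      (forall w u, B w -> B u ->
          (exists v, [/\ B v, v != 1 & u = LM B prec (w * v)]) ->
          prec w u)].

Definition two_sided_groebner_theory n (a : 'I_n -> A) B prec : Prop :=
  skew_mult_basis a B /\ two_sided_monomial_ordering B prec.

Definition left_groebner_theory n (a : 'I_n -> A) B prec : Prop :=
  skew_mult_basis a B /\ left_monomial_ordering B prec.

Definition right_groebner_theory n (a : 'I_n -> A) B prec : Prop :=
  skew_mult_basis a B /\ right_monomial_ordering B prec.

Definition mon_divides B (u v : A) : Prop :=
  exists (c : K) (w s : A), [/\ c != 0, B w, B s & v = c *k: (w * u * s)].

Definition groebner_basis B prec (I : idealType A) (G : set A) : Prop :=
  [/\ (forall g, G g -> g \in I /\ g != 0) &
      (forall f, f \in I -> f != 0 ->
          exists2 g, G g & mon_divides B (LM B prec g) (LM B prec f))].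

Definition minimal_groebner_basis B prec (I : idealType A) (G : set A) : Prop :=
  groebner_basis B prec I G /\
  forall G', G' `<` G -> ~ groebner_basis B prec I G'.

Definition normal_monomials B prec (I : idealType A) : set A :=
  [set u | B u /\
     forall f, f \in I -> f != 0 -> ~ mon_divides B (LM B prec f) u].

(* a_0 ^ alpha_0 * ... * a_(n-1) ^ alpha_(n-1), in this order *)
Definition monomial n (a : 'I_n -> A) (alpha : {ffun 'I_n -> nat}) : A :=
  \prod_(i < n) a i ^+ alpha i.

End Bases.

(* The strict order induced on the classes modulo I of the elements of N of
   the form x ^ alpha by an order [lt] on exponents. *)
Definition induced_order (K : fieldType) (R : pzAlgType K) (I : idealType R)
    (N : set R) n (x : 'I_n -> R) (lt : rel {ffun 'I_n -> nat}) :
    rel (quot_alg I) :=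
  fun a b => `[< exists alpha beta,
    [/\ N (monomial x alpha), N (monomial x beta),
        a = monomial (fun i => pi_alg I (x i)) alpha,
        b = monomial (fun i => pi_alg I (x i)) beta & lt alpha beta] >].

Arguments induced_order {K R} I N {n} x lt.

Section ExponentOrders.
Variable n : nat.
Implicit Types alpha beta : {ffun 'I_n -> nat}.

Definition mdegree alpha : nat := (\sum_i alpha i)%N.

Definition lex alpha beta : bool :=
  [exists i : 'I_n, (alpha i < beta i)%N &&
     [forall k : 'I_n, (k < i)%N ==> (alpha k == beta k)]].

Definition grlex alpha beta : bool :=
  (mdegree alpha < mdegree beta)%N ||
  (mdegree alpha == mdegree beta) && lex alpha beta.

Definition grevlex alpha beta : bool :=
  (mdegree alpha < mdegree beta)%N ||
  (mdegree alpha == mdegree beta) &&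
  [exists i : 'I_n, (beta i < alpha i)%N &&
     [forall k : 'I_n, (i < k)%N ==> (alpha k == beta k)]].

End ExponentOrders.

(* Main.v *)
Require Import Defs.
From HB Require Import structures.
From mathcomp Require Import all_boot all_algebra perm.
From mathcomp Require Import boolp classical_sets.
From mathcomp Require Import monalg.

Set Implicit Arguments.
Unset Strict Implicit.
Unset Printing Implicit Defensive.

Import GRing.Theory.

Local Open Scope classical_set_scope.
Local Open Scope ring_scope.

(* No descent X_{l j} X_{l i} (i < j) divides an ordered monomial X^alpha, so if
   X^alpha is not normal it is divisible by an element of Omega and vanishes in
   A.  Under (i), multiplying an ordered monomial on the left by X_{l q} moves
   the letter to the right, past smaller letters and changing it on the way,
   until it reaches its place: the product is a scalar multiple of an ordered
   monomial whose exponent is alpha plus one unit vector, and the place of that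
   unit vector depends on alpha in a way that preserves the lexicographic
   ordering.  Hence every word is, modulo I, a scalar multiple of an ordered
   monomial; with the independence of normal monomials modulo I this gives the
   skew multiplicative basis and the left admissible ordering.  Case (ii) is the
   mirror image, in the opposite ring and with the reversed order of the
   indices; in case (iii) the letter does not change, and exponents just add. *)

(** * Leading monomials with respect to a well-ordered basis *)

Section AlgScale.
Variables (K : fieldType) (A : pzAlgType K).
Implicit Types (c d : K) (x y : A).

Lemma alg_scale0 x : (0 : K) *k: x = 0.
Proof. by rewrite /alg_scale rmorph0 mul0r. Qed.

Lemma alg_scale1 x : (1 : K) *k: x = x.
Proof. by rewrite /alg_scale rmorph1 mul1r. Qed.

Lemma alg_scaleA c d x : c *k: (d *k: x) = (c * d) *k: x.
Proof. by rewrite /alg_scale rmorphM mulrA. Qed.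

Lemma alg_scaleDl x c d : (c + d) *k: x = c *k: x + d *k: x.
Proof. by rewrite /alg_scale rmorphD mulrDl. Qed.

Lemma alg_scaleBl x c d : (c - d) *k: x = c *k: x - d *k: x.
Proof. by rewrite /alg_scale rmorphB mulrBl. Qed.

Lemma alg_scaleAl c x y : (c *k: x) * y = c *k: (x * y).
Proof. by rewrite /alg_scale mulrA. Qed.

Lemma alg_scaleAr c x y : x * (c *k: y) = c *k: (x * y).
Proof. by rewrite /alg_scale mulrA -alg_scalarC -mulrA. Qed.

Lemma alg_scale_mulr c d x y z t : x = c *k: y -> y * z = d *k: t ->
  x * z = (c * d) *k: t.
Proof. by move=> -> e; rewrite alg_scaleAl e alg_scaleA. Qed.

End AlgScale.

Section WellOrderedBases.
Variables (K : fieldType) (A : pzAlgType K).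
Implicit Types (B : set A) (prec : rel A) (s t : seq A) (c d : A -> K).

Lemma sum_extend s t c : uniq s -> uniq t -> {subset s <= t} ->
  \sum_(u <- t) (if u \in s then c u else 0) *k: u = \sum_(u <- s) c u *k: u.
Proof.
move=> us ut st.
under eq_bigr => u _ do rewrite (fun_if (fun a => a *k: u)) alg_scale0.
rewrite -big_mkcond -big_filter; apply: perm_big.
apply: uniq_perm; rewrite ?filter_uniq // => u.
by rewrite mem_filter; case: (boolP (u \in s)) => // /st.
Qed.

(** The difference of the two combinations, written over the union of the supports, is zero; at an
    element of [s] outside [t] its coefficient would be [c u]. *)
Lemma lin_comb_inj B s t c d : lin_indep B -> uniq s -> uniq t ->
  (forall u, u \in s -> B u) -> (forall u, u \in t -> B u) ->
  \sum_(u <- s) c u *k: u = \sum_(u <- t) d u *k: u ->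
  forall u, u \in s -> c u != 0 -> u \in t.
Proof.
move=> indB us ut sB tB e u su; apply: contraNT => tNu.
pose r := undup (s ++ t).
have sr : {subset s <= r} by move=> v; rewrite mem_undup mem_cat => ->.
have tr : {subset t <= r} by move=> v; rewrite mem_undup mem_cat orbC => ->.
pose b v := (if v \in s then c v else 0) - (if v \in t then d v else 0).
have : b u = 0.
  apply: (indB r b) => //; last exact: sr.
  - exact: undup_uniq.
  - by move=> v; rewrite mem_undup mem_cat => /orP[/sB|/tB].
  under eq_bigr => v _ do rewrite alg_scaleBl.
  by rewrite sumrB !sum_extend ?undup_uniq // e subrr.
by rewrite /b su (negbTE tNu) subr0 => ->.
Qed.

Lemma alg_scale_neq0 B u (a : K) : lin_indep B -> B u -> a != 0 -> a *k: u != 0.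
Proof.
move=> indB Bu a0; apply: contra_neq a0 => e.
apply: (indB [:: u] (fun=> a) _ _ _ u); rewrite ?big_seq1 ?mem_head //.
by move=> v; rewrite inE => /eqP->.
Qed.

Lemma lin_indep_neq0 B u : lin_indep B -> B u -> u != 0.
Proof.
by move=> indB Bu; rewrite -[u]alg_scale1 (alg_scale_neq0 indB) ?oner_neq0.
Qed.

Lemma leads_mem B prec f u t d : lin_indep B -> well_ordering B prec ->
  uniq t -> (forall v, v \in t -> B v) -> f = \sum_(v <- t) d v *k: v ->
  leads B prec f u -> u \in t.
Proof.
move=> indB [irr tra _ _] ut tB -> [s [c [sB ss e]]].
have us : u \in rcons s u by rewrite mem_rcons mem_head.
apply: (lin_comb_inj indB _ ut _ tB (esym e) us); last 2 first.
- by move=> v /sB[].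
- by have [] := sB _ us.
apply: (@sorted_uniq_in _ prec) ss.
- by move=> y x z /sB[By _] /sB[Bx _] /sB[Bz _]; apply: tra.
- by move=> x /sB[/irr/negbTE].
Qed.

Lemma leads_exists B prec f t d : well_ordering B prec ->
  uniq t -> (forall v, v \in t -> B v) -> f = \sum_(v <- t) d v *k: v ->
  f != 0 -> exists u, leads B prec f u.
Proof.
move=> [irr tra tot _] ut tB -> f0.
pose r := [seq v <- t | d v != 0].
have rB v : v \in r -> B v by rewrite mem_filter => /andP[_ /tB].
have er : \sum_(v <- t) d v *k: v = \sum_(v <- r) d v *k: v.
  rewrite big_filter [RHS]big_mkcond; apply: eq_bigr => v _.
  by case: eqVneq => //= ->; rewrite alg_scale0.
pose le x y := (x == y) || prec x y.
pose q := sort le r.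
have qB v : v \in q -> B v by rewrite mem_sort => /rB.
have uq : uniq q by rewrite sort_uniq filter_uniq.
(* Sorting only gives the reflexive closure [le]; since [q] has no duplicates, neighbours are
   strictly related. *)
have sq : sorted prec q.
  have sq : sorted le q.
    apply: (@sort_sorted_in _ [pred v | `[< B v >]] le); last first.
      by apply/allP => v /rB Bv; apply/asboolP.
    move=> x y /asboolP Bx /asboolP By; rewrite /le.
    by case: (tot x y Bx By) => [->|->|->]; rewrite ?eqxx ?orbT.
  clearbody q; case: q uq sq qB => //= x q.
  elim: q x => //= y q IH x /and3P[xy yq uq] /andP[lxy pq] qB.
  rewrite IH ?yq ?uq //; last by move=> v vq; apply: qB; rewrite inE vq orbT.
  move: lxy; rewrite /le => /orP[/eqP exy|->//].
  by rewrite exy mem_head in xy.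
have {}er : \sum_(v <- t) d v *k: v = \sum_(v <- q) d v *k: v.
  by rewrite er; apply: perm_big; rewrite perm_sym perm_sort.
have qd v : v \in q -> d v != 0 by rewrite mem_sort mem_filter => /andP[].
move: f0; rewrite er; clearbody q; case/lastP: q qB qd {uq er} sq => [|q u].
  by rewrite big_nil eqxx.
by move=> qB qd sq _; exists u, q, d; split=> // v vq; split; [apply: qB|apply: qd].
Qed.

(** [LM] is a choice and is never computed: it is located in the support of any expression of [f],
    and a singleton support determines it. *)
Lemma LM_mem B prec f t d : lin_indep B -> well_ordering B prec ->
  uniq t -> (forall v, v \in t -> B v) -> f = \sum_(v <- t) d v *k: v ->
  f != 0 -> LM B prec f \in t.
Proof.
move=> indB wo ut tB e f0; rewrite /LM (negbTE f0).
apply: (leads_mem indB wo ut tB e).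
exact: (@xgetPex _ _ [set u | leads B prec f u] (leads_exists wo ut tB e f0)).
Qed.

Lemma LM_scale B prec u (a : K) : lin_indep B -> well_ordering B prec ->
  B u -> a != 0 -> LM B prec (a *k: u) = u.
Proof.
move=> indB wo Bu a0; apply/eqP; rewrite -mem_seq1.
apply: (@LM_mem B prec _ [:: u] (fun=> a) indB wo) => //.
- by move=> v; rewrite inE => /eqP->.
- by rewrite big_seq1.
- exact: (alg_scale_neq0 indB).
Qed.

Lemma LM_id B prec u : lin_indep B -> well_ordering B prec ->
  B u -> LM B prec u = u.
Proof.
by move=> ib wo Bu; rewrite -{1}[u]alg_scale1 LM_scale // oner_neq0.
Qed.

(** The support is duplicate-free, in contrast to [spanning], so that [LM_mem] applies to it. *)
Definition in_span B (x : A) : Prop := exists (s : seq A) (c : A -> K),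
  [/\ uniq s, forall u, u \in s -> B u & x = \sum_(u <- s) c u *k: u].

Lemma in_span0 B : in_span B 0.
Proof. by exists [::], (fun=> 0); split=> //; rewrite big_nil. Qed.

Lemma in_span_scale B (a : K) u : B u -> in_span B (a *k: u).
Proof.
move=> Bu; exists [:: u], (fun=> a); split=> //; last by rewrite big_seq1.
by move=> v; rewrite inE => /eqP->.
Qed.

Lemma in_spanD B x y : in_span B x -> in_span B y -> in_span B (x + y).
Proof.
move=> [s [c [us sB ->]]] [t [d [ut tB ->]]].
exists (undup (s ++ t)),
  (fun v => (if v \in s then c v else 0) + (if v \in t then d v else 0)).
split; first exact: undup_uniq.
  by move=> v; rewrite mem_undup mem_cat => /orP[/sB|/tB].
under [RHS]eq_bigr => v _ do rewrite alg_scaleDl.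
rewrite big_split !sum_extend ?undup_uniq // => v;
  by rewrite mem_undup mem_cat => ->; rewrite ?orbT.
Qed.

End WellOrderedBases.

(** * Words in the free algebra *)

Lemma monomial_enum (K : fieldType) (A : pzAlgType K) n (a : 'I_n -> A) alpha :
  monomial a alpha = \prod_(i <- enum 'I_n) a i ^+ alpha i.
Proof. by rewrite -deprecated_filter_index_enum big_filter; apply: eq_bigl. Qed.

Section Words.
Variables (K : fieldType) (n : nat).
Implicit Types (s t : seq 'I_n) (f : free_alg K n).

Definition word s : free_alg K n := \prod_(i <- s) gen K i.

Lemma word_cat s t : word (s ++ t) = word s * word t.
Proof. exact: big_cat. Qed.

Lemma word1 i : word [:: i] = gen K i.
Proof. exact: big_seq1. Qed.

Lemma wordE s : word s = << FMonom s >>.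
Proof.
rewrite /word; elim: s => [|i s IH]; first by rewrite big_nil -fmoneE.
rewrite big_cons IH /gen malgM_def fgmulUU mulr1; congr << _ >>.
by apply/eqP; rewrite fmP fmM fmU.
Qed.

Lemma mcoeff_word s m : (word s)@_m = (FMonom s == m)%:R.
Proof. by rewrite wordE mcoeffU1. Qed.

Lemma word_inj : injective word.
Proof.
move=> s t /(congr1 (mcoeff (FMonom t))); rewrite !mcoeff_word eqxx.
by case: eqVneq => [[]|] // _ /eqP; rewrite eq_sym oner_eq0.
Qed.

Lemma wordsP u : words K n u <-> exists s, u = word s.
Proof.
split=> [[m _ <-]|[s ->]]; last by exists (FMonom s); rewrite ?wordE.
by exists (fmonom_val m); rewrite wordE fmK.
Qed.

Lemma word_words s : words K n (word s).
Proof. by apply/wordsP; exists s. Qed.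

Lemma words_lin_indep : lin_indep (words K n).
Proof.
move=> s c us sB e u su; have /wordsP[r er] := sB _ su.
move/(congr1 (mcoeff (FMonom r))): e; rewrite mcoeff0 raddf_sum /=.
rewrite (bigD1_seq u) //= big_seq_cond big1 => [|v /andP[sv vu]].
  by rewrite er free_alg_scaleE mcoeffZ mcoeff_word eqxx mulr1 addr0.
have /wordsP[q eq] := sB _ sv; rewrite eq free_alg_scaleE mcoeffZ mcoeff_word.
case: eqVneq => [[eqr]|]; last by rewrite mulr0.
by rewrite eq eqr -er eqxx in vu.
Qed.

Lemma in_span_words f : in_span (words K n) f.
Proof.
rewrite [f]monalgE; elim: (finmap.enum_fset _) => [|m s IH].
  by rewrite big_nil; apply: in_span0.
rewrite big_cons; apply: in_spanD => //.
have -> : << f@_m *g m >> = f@_m *k: word (fmonom_val m) :> free_alg K n.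
  apply/malgP => k; rewrite free_alg_scaleE mcoeffZ mcoeff_word mcoeffU fmK.
  by rewrite mulr_natr.
exact/in_span_scale/word_words.
Qed.

(** Comparing the coefficient at [t] forces the product to be [t] itself, so divisibility between
    words is occurrence as a contiguous factor. *)
Lemma mon_divides_word s t : mon_divides (words K n) (word s) (word t) ->
  exists a b, t = a ++ s ++ b.
Proof.
move=> [c [w [v [c0 /wordsP[a ->] /wordsP[b ->]]]]].
rewrite -!word_cat -catA free_alg_scaleE => /(congr1 (mcoeff (FMonom t))).
rewrite mcoeffZ !mcoeff_word eqxx; case: eqVneq => [[<-]|_ /eqP].
  by exists a, b.
by rewrite mulr0 oner_eq0.
Qed.

Lemma mon_divides_cat a s b :
  mon_divides (words K n) (word s) (word (a ++ s ++ b)).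
Proof.
exists 1, (word a), (word b); split; rewrite ?oner_neq0 //; try exact: word_words.
by rewrite alg_scale1 -!word_cat catA.
Qed.

Lemma mon_divides_trans u v w : words K n u -> words K n v -> words K n w ->
  mon_divides (words K n) u v -> mon_divides (words K n) v w ->
  mon_divides (words K n) u w.
Proof.
move=> /wordsP[s ->] /wordsP[t ->] /wordsP[r ->].
move=> /mon_divides_word[a [b ->]] /mon_divides_word[a' [b' ->]].
by rewrite -!catA [a' ++ _]catA; apply: mon_divides_cat.
Qed.

Lemma mon_divides_refl u : words K n u -> mon_divides (words K n) u u.
Proof. by move=> /wordsP[s ->]; have := mon_divides_cat [::] s [::]; rewrite cats0. Qed.

Definition exponent_word (l : 'I_n -> 'I_n) (alpha : {ffun 'I_n -> nat}) :=
  flatten [seq nseq (alpha i) (l i) | i <- enum 'I_n].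

Lemma monomialE (l : 'I_n -> 'I_n) alpha :
  monomial (fun i => gen K (l i)) alpha = word (exponent_word l alpha).
Proof.
rewrite monomial_enum /exponent_word; elim: (enum _) => [|i s IH].
  by rewrite big_nil /word big_nil.
rewrite big_cons IH /= word_cat; congr (_ * _).
elim: (alpha i) => [|k IHk]; first by rewrite /word big_nil.
by rewrite exprS IHk -word1 -word_cat.
Qed.

(** The entry at [i] is recovered as the number of occurrences of [l i], [l] being injective. *)
Lemma exponent_word_inj (l : {perm 'I_n}) : injective (exponent_word l).
Proof.
have cnt a i : count_mem (l i) (exponent_word l a) = a i.
  rewrite /exponent_word count_flatten -map_comp sumnE big_map big_enum /=.
  rewrite (bigD1 i) //= count_nseq /= eqxx mul1n big1 ?addn0 // => k ki.
  by rewrite count_nseq /= (inj_eq perm_inj) (negbTE ki).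
by move=> a b e; apply/ffunP => i; rewrite -cnt e cnt.
Qed.

Lemma exponent_word_id_sorted alpha :
  sorted leq (map val (exponent_word id alpha)).
Proof.
rewrite /exponent_word map_flatten -map_comp.
have := iota_ltn_sorted 0 n; rewrite -val_enum_ord.
elim: (enum 'I_n) => //= i s IH pis.
rewrite map_nseq sorted_pairwise ?pairwise_cat; last exact: leq_trans.
rewrite -!(sorted_pairwise leq_trans) IH ?(path_sorted pis) // andbT.
apply/andP; split.
  apply/allrelP => x y /nseqP[-> _] /flattenP[z /mapP[j sj ->]] /=.
  rewrite map_nseq => /nseqP[-> _]; apply: ltnW.
  by have /allP := order_path_min ltn_trans pis; apply; apply: map_f.
by elim: (alpha i) => //= -[|k] //= ->; rewrite leqnn.
Qed.

(** Undoing [l] leaves a weakly increasing word. This excludes every leading word of the [g j i] as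
    a factor of an ordered monomial. *)
Lemma exponent_word_sorted (l : {perm 'I_n}) alpha a b i j :
  exponent_word l alpha = a ++ [:: l j; l i] ++ b -> (j <= i)%N.
Proof.
move=> e; have {}e : exponent_word id alpha =
    map (l^-1)%g a ++ [:: j; i] ++ map (l^-1)%g b.
  move/(congr1 (map (l^-1)%g)): e; rewrite !map_cat /= !permK => <-.
  rewrite /exponent_word map_flatten -map_comp; congr flatten.
  by apply: eq_map => k /=; rewrite map_nseq permK.
have := exponent_word_id_sorted alpha; rewrite e !map_cat.
by move=> /cat_sorted2[_] /andP[].
Qed.

End Words.

(** * Orderings of exponents *)

Section ExponentOrders.
Variable n : nat.
Local Notation exponent := {ffun 'I_n -> nat}.
Implicit Types (a b c : exponent) (r : rel exponent) (S : set exponent).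

Definition strict_total r : Prop :=
  [/\ irreflexive r, transitive r & forall a b, a != b -> r a b || r b a].

Definition has_least r S : Prop :=
  exists2 m, S m & forall a, S a -> a != m -> r m a.

Definition expD a b : exponent := [ffun i => (a i + b i)%N].

Definition exp1 (q : 'I_n) : exponent := [ffun i => (i == q) : nat].

Definition translation_invariant r : Prop :=
  forall a b c, r a b -> r (expD c a) (expD c b).

Lemma lexP a b : reflect
  (exists i : 'I_n, (a i < b i)%N /\ forall k : 'I_n, (k < i)%N -> a k = b k)
  (lex a b).
Proof.
apply: (iffP existsP) => [[i /andP[abi /forallP e]]|[i [abi e]]]; exists i.
  by split=> // k ki; have /implyP/(_ ki)/eqP := e k.
by rewrite abi; apply/forallP => k; apply/implyP => /e->.
Qed.

Lemma lex_strict_total : strict_total (@lex n).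
Proof.
split=> [a|b a c /lexP[i [abi ei]] /lexP[j [bcj ej]]|a b nab].
- by apply/lexP => -[i []]; rewrite ltnn.
- apply/lexP; case: (ltngtP i j) => [ij|ji|/val_inj ij].
  + exists i; split=> [|k ki]; first by rewrite -ej.
    by rewrite ei // ej // (ltn_trans ki).
  + exists j; split=> [|k kj]; first by rewrite ei.
    by rewrite ei ?ej // (ltn_trans kj).
  + subst j; exists i; split=> [|k ki]; first exact: ltn_trans bcj.
    by rewrite ei ?ej.
have [i0 i0P] : exists i, a i != b i.
  by apply/existsP; apply: contraNT nab => /existsPn e;
    apply/eqP/ffunP => i; apply/eqP/negPn/e.
case: (@arg_minnP _ i0 (fun i => a i != b i) val i0P) => i abi imin.
have e (k : 'I_n) : (k < i)%N -> a k = b k.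
  by move=> ki; apply/eqP; apply: contraLR ki => /imin; rewrite -leqNgt.
move: abi; rewrite neq_ltn => /orP[abi|bai]; apply/orP; [left|right]; apply/lexP.
  by exists i.
by exists i; split=> // k /e.
Qed.

Lemma exists_minimal (T : Type) (P : set T) (f : T -> nat) :
  P !=set0 -> exists2 m, P m & forall x, P x -> (f m <= f x)%N.
Proof.
move=> [x0 Px0].
have ex : exists k, `[< exists2 x, P x & f x = k >].
  by exists (f x0); apply/asboolP; exists x0.
case: (ex_minnP ex) => k /asboolP[m Pm fm] kmin; exists m => // x Px.
by rewrite fm; apply: kmin; apply/asboolP; exists x.
Qed.

Lemma lex_has_least S : S !=set0 -> has_least (@lex n) S.
Proof.
move=> S0.
(* [m] is least for the lexicographic comparison of the first [k] entries. *)
have step k : (k <= n)%N -> exists2 m, S m & forall a, S a ->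
    (forall i : 'I_n, (i < k)%N -> m i = a i) \/
    exists i : 'I_n, [/\ (i < k)%N, (m i < a i)%N &
                         forall j : 'I_n, (j < i)%N -> m j = a j].
  elim: k => [_|k IH kn]; first by have [m Sm] := S0; exists m => // a _; left.
  have [m Sm mP] := IH (ltnW kn); pose o := Ordinal kn.
  (* Among the elements agreeing with [m] on the first [k] entries, one with least entry at [o] is
     least for one more index. *)
  pose S' := [set a | S a /\ forall i : 'I_n, (i < k)%N -> m i = a i].
  have [|m' [Sm' m'P] m'min] := @exists_minimal _ S' (fun a => a o).
    by exists m.
  exists m' => // a Sa; have [ea|[i [ik mai ei]]] := mP a Sa; last first.
    right; exists i; rewrite -m'P //; split=> // [|j ji]; first exact: ltnW.
    by rewrite -m'P ?ei // (ltn_trans ji).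
  have agree (j : 'I_n) : (j < k)%N -> m' j = a j by move=> jk; rewrite -m'P ?ea.
  move: (m'min a (conj Sa ea)); rewrite leq_eqVlt => /orP[/eqP e|lt]; last first.
    by right; exists o.
  left=> j; rewrite ltnS leq_eqVlt => /orP[/eqP jk|/agree//].
  by have -> : j = o by apply: val_inj.
have [m Sm mP] := step n (leqnn n); exists m => // a Sa am.
have [e|[i [_ mai ei]]] := mP a Sa; last by apply/lexP; exists i.
by case/eqP: am; apply/ffunP => i; rewrite e.
Qed.

Definition graded r : rel exponent := fun a b =>
  (mdegree a < mdegree b)%N || (mdegree a == mdegree b) && r a b.

Lemma graded_strict_total r : strict_total r -> strict_total (graded r).
Proof.
move=> [irr tra tot]; split=> [a|b a c|a b nab]; rewrite /graded.
- by rewrite ltnn irr andbF.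
- case/orP=> [ab|/andP[/eqP-> ab]] /orP[bc|/andP[/eqP<- bc]].
  + by rewrite (ltn_trans ab).
  + by rewrite ab.
  + by rewrite bc.
  + by rewrite eqxx (tra b) ?orbT.
- by case: ltngtP => //= _; apply: tot.
Qed.

(** The lowest degree is selected first, so minima of [r] are required only on sets of constant
    degree. This matters for [revlex], which has infinite descending chains across degrees. *)
Lemma graded_has_least r S : S !=set0 ->
  (forall d S', S' !=set0 -> (forall a, S' a -> mdegree a = d) ->
     has_least r S') ->
  has_least (graded r) S.
Proof.
move=> S0 rmin; have [m0 Sm0 m0min] := exists_minimal (@mdegree n) S0.
have [||m [Sm dm] mmin] :=
    rmin (mdegree m0) [set a | S a /\ mdegree a = mdegree m0].
- by exists m0.
- by move=> a [].
exists m => // a Sa am; rewrite /graded dm; have := m0min a Sa.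
by case: ltngtP => // e _; apply: mmin.
Qed.

Definition exp_rev a : exponent := [ffun i => a (rev_ord i)].

Lemma exp_revK : involutive exp_rev.
Proof. by move=> a; apply/ffunP => i; rewrite !ffunE rev_ordK. Qed.

(** Reversing the indices turns the last difference into the first one; the exchanged arguments make
    the larger entry the smaller exponent. *)
Definition revlex : rel exponent := fun a b => lex (exp_rev b) (exp_rev a).

Lemma rev_ord_ltn (i j : 'I_n) : (rev_ord i < rev_ord j)%N = (j < i)%N.
Proof. by rewrite /= ltn_sub2lE // ltnS. Qed.

Lemma grevlexE : @grevlex n = graded revlex.
Proof.
apply/funext => a; apply/funext => b; rewrite /grevlex /graded /revlex.
congr (_ || _ && _); apply/existsP/lexP => [[i /andP[bai /forallP e]]|].
  exists (rev_ord i); rewrite !ffunE rev_ordK; split=> // k ki; rewrite !ffunE.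
  have /implyP := e (rev_ord k); rewrite -rev_ord_ltn rev_ordK => /(_ ki).
  by move/eqP.
move=> [i []]; rewrite !ffunE => bai e; exists (rev_ord i); rewrite bai.
apply/forallP => k; apply/implyP; rewrite -rev_ord_ltn rev_ordK => /e.
by rewrite !ffunE rev_ordK => ->.
Qed.

Lemma grlexE : @grlex n = graded (@lex n). Proof. by []. Qed.

Lemma revlex_strict_total : strict_total revlex.
Proof.
have [irr tra tot] := lex_strict_total; rewrite /revlex.
split=> [a|b a c ab bc|a b nab]; first exact: irr.
  exact: tra bc ab.
by rewrite orbC tot // (can_eq exp_revK).
Qed.

(** In degree [d] all entries are at most [d], so reversing the indices and replacing each entry by
    its complement to [d] turns [revlex] into [lex]. *)
Lemma revlex_has_least d S : S !=set0 -> (forall a, S a -> mdegree a = d) ->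
  has_least revlex S.
Proof.
move=> [a0 Sa0] Sd.
have le_d a i : S a -> (a i <= d)%N.
  by move=> /Sd <-; rewrite /mdegree (bigD1 i) //= leq_addr.
pose compl a : exponent := [ffun i => (d - exp_rev a i)%N].
have compl_inj a b : S a -> S b -> compl a = compl b -> a = b.
  move=> Sa Sb e; apply/ffunP => i; have /ffunP/(_ (rev_ord i)) := e.
  by rewrite !ffunE rev_ordK => /(congr1 (subn d)); rewrite !subKn ?le_d.
have [|m [a Sa <-] amin] := @lex_has_least [set compl a | a in S].
  by exists (compl a0), a0.
exists a => // b Sb ba.
have compl_ba : compl b != compl a by apply: contra_neq ba => /compl_inj->.
have /lexP[i [abi e]] := amin (compl b) (ex_intro2 _ _ b Sb erefl) compl_ba.
apply/lexP; exists i; move: abi; rewrite !ffunE => abi; split.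
  by rewrite ltnNge; apply: contraL abi => ab; rewrite -leqNgt leq_sub2l.
move=> k /e; rewrite !ffunE => /(congr1 (subn d)).
by rewrite !subKn ?le_d.
Qed.

Lemma mdegreeD a b : mdegree (expD a b) = (mdegree a + mdegree b)%N.
Proof.
by rewrite /mdegree -big_split; apply: eq_bigr => i _; rewrite ffunE.
Qed.

Lemma mdegree1 q : mdegree (exp1 q) = 1%N.
Proof.
rewrite /mdegree (bigD1 q) //= ffunE eqxx big1 // => i iq.
by rewrite ffunE (negbTE iq).
Qed.

Lemma lexD : translation_invariant (@lex n).
Proof.
move=> a b c /lexP[i [abi e]]; apply/lexP; exists i; rewrite !ffunE ltn_add2l.
by split=> // k /e ek; rewrite !ffunE ek.
Qed.

Lemma revlexD : translation_invariant revlex.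
Proof.
have exp_revD a b : exp_rev (expD a b) = expD (exp_rev a) (exp_rev b).
  by apply/ffunP => i; rewrite !ffunE.
by move=> a b c ab; rewrite /revlex !exp_revD; apply: lexD.
Qed.

Lemma gradedD r : translation_invariant r -> translation_invariant (graded r).
Proof.
move=> rD a b c; rewrite /graded !mdegreeD ltn_add2l eqn_add2l.
by case/orP=> [->//|/andP[-> /(rD _ _ c)->]]; rewrite orbT.
Qed.

(** The degree alone decides. For [revlex] the grading is essential here: without it, adding a unit
    vector would make an exponent smaller. *)
Lemma graded_exp1D r a q : graded r a (expD (exp1 q) a).
Proof. by rewrite /graded mdegreeD mdegree1 add1n ltnSn. Qed.

Lemma lex_exp1D a q : lex a (expD (exp1 q) a).
Proof.
apply/lexP; exists q; rewrite !ffunE eqxx ltnSn; split=> // k kq.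
by rewrite !ffunE -val_eqE ltn_eqF.
Qed.

Lemma lex_exp1 (i j : 'I_n) : (i < j)%N -> lex (exp1 j) (exp1 i).
Proof.
move=> ij; apply/lexP; exists i; rewrite !ffunE eqxx -val_eqE ltn_eqF //.
split=> // k ki; rewrite !ffunE -!val_eqE (ltn_eqF ki) ltn_eqF //.
exact: ltn_trans ij.
Qed.

Lemma revlex_exp1 (i j : 'I_n) : (i < j)%N -> revlex (exp1 j) (exp1 i).
Proof.
have exp_rev1 q : exp_rev (exp1 q) = exp1 (rev_ord q).
  by apply/ffunP => k; rewrite !ffunE (can2_eq rev_ordK rev_ordK).
by move=> ij; rewrite /revlex !exp_rev1 lex_exp1 // rev_ord_ltn.
Qed.

Lemma graded_exp1 r i j : r (exp1 j) (exp1 i) -> graded r (exp1 j) (exp1 i).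
Proof. by rewrite /graded !mdegree1 ltnn eqxx. Qed.

End ExponentOrders.

(** * Insertion of a letter into an ordered monomial *)

(* Left multiplication of x_{k1}^{a_1} x_{k2}^{a_2} ... by x_q under relations
   x_j x_i = c x_i x_{p j i} with r i j and r i (p j i): the index q is changed
   while it passes the blocks to its right, until it reaches its place. *)
Section Insertion.
Variables (K : fieldType) (n : nat) (r : rel 'I_n) (p : 'I_n -> 'I_n -> 'I_n).
Hypotheses (r_irr : irreflexive r) (r_trans : transitive r).
Hypothesis r_p : forall i j, r i j -> r i (p j i).
Implicit Types (a b : {ffun 'I_n -> nat}) (ks : seq 'I_n) (q k : 'I_n).

(** The index at which the letter comes to rest. Passing the block of [x k] applies [p^~ k] once for
    each of its [a k] copies. *)
Definition carry a ks q : 'I_n :=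
  foldl (fun q k => if r k q then iter (a k) (p^~ k) q else q) q ks.

(** Common form of two orderings: with [<] for [r] it is [lex], with [>] it is [revlex] with
    exchanged arguments. *)
Definition first_diff a b : Prop :=
  exists d, (a d < b d)%N /\ forall k, r k d -> a k = b k.

Lemma r_iter_p k q m : r k q -> r k (iter m (p^~ k) q).
Proof. by move=> kq; elim: m => //= m /r_p. Qed.

(** The index changes only at some [k] beyond [d], and afterwards it is still beyond that [k]. *)
Lemma carry_above a d ks q : all (r d) ks -> r d q -> r d (carry a ks q).
Proof.
elim: ks q => //= k ks IH q /andP[dk dks] dq; apply: IH => //.
by case: ifP => // kq; apply: (r_trans dk); apply: r_iter_p.
Qed.

(** By transitivity, an index not beyond [d] is not beyond any later [k], so no block changes it. *)
Lemma carry_stop a d ks q : all (r d) ks -> ~~ r d q -> carry a ks q = q.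
Proof.
elim: ks q => //= k ks IH q /andP[dk dks] dq.
by rewrite ifN ?IH //; apply: contra dq; apply: r_trans.
Qed.

Lemma eq_carry a b ks q : (forall k, k \in ks -> a k = b k) ->
  carry a ks q = carry b ks q.
Proof.
elim: ks q => //= k ks IH q e; rewrite e ?mem_head //.
by apply: IH => j jks; rewrite e // inE jks orbT.
Qed.

(** Up to the first difference [d] both exponents move the letter alike, so it reaches [d] with the
    same index [q1]. If [q1] is beyond [d], both unit vectors land strictly beyond [d] and leave the
    comparison untouched; otherwise the letter has stopped and the same unit vector is added to
    both. *)
Lemma first_diff_insert ks q a b : pairwise r ks -> (forall k, k \in ks) ->
  first_diff a b ->
  first_diff (expD (exp1 (carry a ks q)) a) (expD (exp1 (carry b ks q)) b).
Proof.
move=> srt full [d [abd e]].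
case/splitPr: (full d) srt => k1 k2.
rewrite pairwise_cat /= => /and4P[/allrelP k12 _ dk2 _].
have ek1 : carry a k1 q = carry b k1 q.
  by apply: eq_carry => k kk1; apply/e/k12; rewrite ?mem_head.
rewrite /carry !foldl_cat /= -!/(carry _ _ _) ek1.
set q1 := carry b k1 q.
exists d; rewrite !ffunE; case: (boolP (r d q1)) => dq1.
  have above c : r d (carry c k2 (iter (c d) (p^~ d) q1)).
    by apply: carry_above => //; apply: r_iter_p.
  have ne c k : k = d \/ r k d -> (k == carry c k2 (iter (c d) (p^~ d) q1)) = false.
    move=> kd; apply/eqP => ke; have := above c; rewrite -ke.
    by case: kd => [->|kd dk]; [rewrite r_irr|move: (r_trans kd dk); rewrite r_irr].
  rewrite !ne; try by left.
  by split=> // k kd; rewrite !ffunE !ne ?e //; right.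
rewrite !(@carry_stop _ d k2) // ltn_add2l; split=> // k kd; rewrite !ffunE e //.
Qed.

Variables (T : pzRingType) (sc : K -> T) (x : 'I_n -> T).
Hypotheses (sc1 : sc 1 = 1) (scM : forall c d, sc (c * d) = sc c * sc d).
Hypothesis scC : forall c y, sc c * y = y * sc c.
Hypothesis x_swap : forall i j, r i j ->
  exists c, x j * x i = sc c * (x i * x (p j i)).

(** With each copy of [x k] that is passed the index changes by [p^~ k]; it remains beyond [k], so
    the relation applies again. *)
Lemma swap_iter k q m : r k q ->
  exists c, x q * x k ^+ m = sc c * (x k ^+ m * x (iter m (p^~ k) q)).
Proof.
move=> kq; elim: m => [|m [c IH]].
  by exists 1; rewrite !expr0 sc1 !mul1r mulr1.
have [d e] := x_swap (r_iter_p m kq); exists (c * d).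
rewrite exprSr mulrA IH -!mulrA e scM -!mulrA; congr (_ * _).
by rewrite !mulrA scC.
Qed.

(** Induction on the blocks, for lists closed upwards under [r] so that the changed index still
    occurs in the tail. A ring with a central multiplicative map [sc] takes the place of an algebra,
    which allows use in the converse ring. *)
Lemma insert_prod a ks q : pairwise r ks ->
  (forall i j, i \in ks -> r i j -> j \in ks) -> q \in ks ->
  exists c, x q * \prod_(k <- ks) x k ^+ a k =
            sc c * \prod_(k <- ks) x k ^+ expD (exp1 (carry a ks q)) a k.
Proof.
elim: ks q => //= k ks IH q /andP[kks srt] up; rewrite inE => qks.
have up' i j : i \in ks -> r i j -> j \in ks.
  move=> iks ij; have ki := allP kks _ iks.
  have := up i j; rewrite !inE iks orbT ij => /(_ isT isT) /orP[/eqP jk|//].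
  by have := r_trans ki ij; rewrite jk r_irr.
have ksk i : i \in ks -> (i == k) = false.
  by move=> /(allP kks) ki; apply/eqP => ik; rewrite ik r_irr in ki.
(* Either the letter belongs to the first block and is absorbed by it, or its block comes later and
   it must pass the first one. *)
rewrite !big_cons; case: eqVneq qks => [-> _|qk /= qks].
  rewrite r_irr (carry_stop _ kks) ?r_irr //; exists 1.
  rewrite sc1 mul1r mulrA -exprS !ffunE eqxx; congr (_ * _).
  by apply: eq_big_seq => i /ksk ik; rewrite !ffunE ik.
have kq := allP kks _ qks; rewrite kq.
have kq' := r_iter_p (a k) kq.
have q'ks : iter (a k) (p^~ k) q \in ks.
  have := up k _ (mem_head _ _) kq'; rewrite inE => /orP[/eqP e|//].
  by rewrite e r_irr in kq'.
have [c e] := swap_iter (a k) kq; have [d e'] := IH _ srt up' q'ks.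
exists (c * d); rewrite mulrA e -!mulrA e' scM -!mulrA; congr (_ * _).
rewrite [in RHS]/expD ffunE ffunE.
have /negbTE-> : k != carry a ks (iter (a k) (p^~ k) q).
  by apply/eqP => ke; have := carry_above a kks kq'; rewrite -ke r_irr.
by rewrite add0n !mulrA scC.
Qed.

End Insertion.

Section AlgebraInsertion.
Variables (K : fieldType) (A : pzAlgType K) (n : nat).
Variables (r : rel 'I_n) (p : 'I_n -> 'I_n -> 'I_n) (x : 'I_n -> A).
Hypotheses (r_irr : irreflexive r) (r_trans : transitive r).
Hypothesis r_p : forall i j, r i j -> r i (p j i).
Implicit Types (a : {ffun 'I_n -> nat}) (ks : seq 'I_n) (q : 'I_n).

Lemma insert_prod_left a ks q :
  (forall i j, r i j -> exists c : K, x j * x i = c *k: (x i * x (p j i))) ->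
  pairwise r ks -> (forall k, k \in ks) ->
  exists c : K, x q * \prod_(k <- ks) x k ^+ a k =
    c *k: \prod_(k <- ks) x k ^+ expD (exp1 (carry r p a ks q)) a k.
Proof.
move=> swap srt full.
exact: (insert_prod r_irr r_trans r_p (rmorph1 (@alg_scalar K A))
  (rmorphM (@alg_scalar K A)) (@alg_scalarC K A) swap a srt).
Qed.

Lemma converse_exp (y : A) m : @GRing.exp A^c y m = y ^+ m.
Proof. by elim: m => // m IH; rewrite [LHS]exprSr [RHS]exprS -IH. Qed.

Lemma insert_prod_right a ks q :
  (forall i j, r i j -> exists c : K, x i * x j = c *k: (x (p j i) * x i)) ->
  pairwise r ks -> (forall k, k \in ks) ->
  exists c : K, (\prod_(k <- rev ks) x k ^+ a k) * x q =
    c *k: \prod_(k <- rev ks) x k ^+ expD (exp1 (carry r p a ks q)) a k.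
Proof.
(* This is [insert_prod] in the converse ring. *)
move=> swap srt full; pose sc (c : K) : A^c := alg_scalar c.
have scM c d : sc (c * d) = sc c * sc d.
  by rewrite /sc mulrC; apply: (rmorphM (@alg_scalar K A)).
have scC c y : sc c * y = y * sc c by apply/esym/(@alg_scalarC K A).
pose xc : 'I_n -> A^c := x.
have swap' i j : r i j ->
    exists c, xc j * xc i = sc c * (xc i * xc (p j i)).
  by move=> /swap[c e]; exists c; rewrite scC; apply: e.
have [//|c] := @insert_prod _ _ _ _ r_irr r_trans r_p A^c sc xc
  (rmorph1 (@alg_scalar K A)) scM scC swap' a ks q srt _ (full q).
rewrite scC !rev_prodr => e; exists c; move: e.
have expE (b : {ffun 'I_n -> nat}) k : xc k ^+ b k = x k ^+ b k by apply: converse_exp.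
under eq_bigr => k _ do rewrite expE.
under [in RHS]eq_bigr => k _ do rewrite expE.
by [].
Qed.

End AlgebraInsertion.

(** * Normal monomials modulo an ideal *)

Section NormalMonomials.
Variables (K : fieldType) (n : nat) (prec : rel (free_alg K n)).
Variable I : idealType (free_alg K n).
Hypothesis wo : well_ordering (words K n) prec.
Local Notation R := (free_alg K n).
Local Notation B := (words K n).
Local Notation A := (quot_alg I).
Local Notation pi := (pi_alg I).
Local Notation N := (normal_monomials B prec I).
Local Notation Nbar := [set pi u | u in N].

Lemma pi_alg_scale (c : K) (u : R) : pi (c *k: u) = c *k: pi u.
Proof. exact: (rmorphM pi). Qed.

(** A nonzero combination in [I] would have its leading monomial among the normal words of its
    support, and that word divides itself. *)
Lemma normal_independent_mod (s : seq R) (c : R -> K) : uniq s ->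
  (forall u, u \in s -> N u) -> \sum_(u <- s) c u *k: u \in I ->
  forall u, u \in s -> c u = 0.
Proof.
move=> us sN If; have sB u : u \in s -> B u by move=> /sN[].
apply: (words_lin_indep us sB); apply/eqP; apply: contraT => f0.
have /sN[Bu] := LM_mem (@words_lin_indep K n) wo us sB erefl f0.
by move/(_ _ If f0) => []; apply: mon_divides_refl.
Qed.

Lemma pi_alg_normal_inj u v : N u -> N v -> pi u = pi v -> u = v.
Proof.
move=> Nu Nv /pi_algP Iuv; apply/eqP; apply: contraT => nuv.
pose c w : K := if w == u then 1 else -1.
have : c u = 0.
  apply: (@normal_independent_mod [:: u; v]); rewrite ?mem_head //=.
  - by rewrite inE nuv.
  - by move=> w; rewrite !inE => /orP[]/eqP->.
  rewrite big_cons big_seq1 /c eqxx [v == u]eq_sym (negbTE nuv).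
  by rewrite /alg_scale rmorphN !rmorph1 mul1r mulN1r.
by rewrite /c eqxx => /eqP; rewrite oner_eq0.
Qed.

Lemma normal_classes_lin_indep : lin_indep Nbar.
Proof.
move=> s c us sN e a sa.
(* Each class is lifted to a normal word; distinct classes have distinct lifts, so independence
   modulo [I] applies to the lifted combination. *)
pose lift b : R := xget 0 [set u | N u /\ pi u = b].
have liftP b : b \in s -> N (lift b) /\ pi (lift b) = b.
  move=> /sN[u Nu eu].
  by apply: (@xgetPex _ _ [set u | N u /\ pi u = b]); exists u.
have := @normal_independent_mod (map lift s) (fun u => c (pi u)) _ _ _ (lift a).
rewrite (liftP _ sa).2; apply; last exact: map_f.
- rewrite map_inj_in_uniq // => b b' sb sb' eb.
  by rewrite -(liftP _ sb).2 -(liftP _ sb').2 eb.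
- by move=> u /mapP[b /liftP[Nb _] ->].
rewrite -[X in X \in I]subr0; apply/pi_algP; rewrite raddf0 raddf_sum big_map -[RHS]e.
by apply: eq_big_seq => b /liftP[_ eb]; rewrite -[LHS]/(pi _) pi_alg_scale eb.
Qed.

Variable l : {perm 'I_n}.
Local Notation X := (fun i => gen K (l i) : R).
Local Notation Xbar := (fun i => pi (X i)).

Lemma monomial_pi_alg alpha : monomial Xbar alpha = pi (monomial X alpha).
Proof.
by rewrite /monomial rmorph_prod; apply: eq_bigr => i _; rewrite rmorphXn.
Qed.

Lemma monomial_inj alpha beta : N (monomial X alpha) -> N (monomial X beta) ->
  monomial Xbar alpha = monomial Xbar beta -> alpha = beta.
Proof.
move=> Na Nb; rewrite !monomial_pi_alg => /(pi_alg_normal_inj Na Nb).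
by rewrite !monomialE => /word_inj/exponent_word_inj.
Qed.

(** These two facts carry all that is used of the relations: the first will come from the Groebner
    basis, the second from insertion of letters. *)
Hypothesis monomial_normal :
  forall alpha, monomial Xbar alpha != 0 -> N (monomial X alpha).
Hypothesis word_straighten : forall s,
  exists c alpha, pi (word K s) = c *k: monomial Xbar alpha.

(** A normal word need not be given as an ordered monomial. Straightening writes its class as a
    scalar multiple of one, which is nonzero, hence normal; linear independence then forces the two
    basis elements to coincide. *)
Lemma normal_classP a : Nbar a ->
  exists2 alpha, N (monomial X alpha) & a = monomial Xbar alpha.
Proof.
move=> Na; have [u Nu eu] := Na; have /wordsP[s es] := Nu.1.
have [c [alpha e]] := word_straighten s.
have a0 := lin_indep_neq0 normal_classes_lin_indep Na.
have Nalpha : N (monomial X alpha).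
  apply: monomial_normal; apply: contra_neq a0 => m0.
  by rewrite -eu es e m0 /alg_scale mulr0.
exists alpha; first exact: Nalpha.
have seq1N b : Nbar b -> forall v, v \in [:: b] -> Nbar v.
  by move=> Nb v; rewrite inE => /eqP->.
have Nm : Nbar (monomial Xbar alpha).
  by exists (monomial X alpha); [exact: Nalpha|rewrite monomial_pi_alg].
have e1 : \sum_(u <- [:: a]) 1 *k: u =
          \sum_(u <- [:: monomial Xbar alpha]) c *k: u.
  by rewrite !big_seq1 alg_scale1 -e -es eu.
have := lin_comb_inj normal_classes_lin_indep (isT : uniq [:: a])
  (isT : uniq [:: monomial Xbar alpha]) (seq1N _ Na) (seq1N _ Nm) e1.
move=> /(_ a (mem_head _ _) (oner_neq0 _)).
by rewrite inE => /eqP.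
Qed.

Lemma monomial_class alpha : monomial Xbar alpha != 0 ->
  Nbar (monomial Xbar alpha).
Proof.
by move=> /monomial_normal Na; exists (monomial X alpha); rewrite ?monomial_pi_alg.
Qed.

(** Straightening makes the class of every word a scalar multiple of an ordered monomial, which is
    either zero or the class of a normal word; spanning and the product rule follow. *)
Lemma normal_classes_basis :
  skew_mult_basis (fun i => pi (gen K i)) Nbar.
Proof.
split.
- move=> S [S1 SD SZ SM] Sg; apply/seteqP; split=> // a _.
  rewrite -[a]pi_algK; have [s [c [_ sB ->]]] := in_span_words (repr a).
  rewrite raddf_sum; elim: s sB => [|u s IH] sB.
    (* Zero belongs to a subalgebra as the multiple of 1 by the scalar 0. *)
    by rewrite big_nil -(alg_scale0 1); apply: SZ.
  rewrite big_cons; apply: SD; last first.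
    by apply: IH => v vs; apply: sB; rewrite inE vs orbT.
  rewrite -[X in S X]/(pi _) pi_alg_scale; apply: SZ.
  have /wordsP[t ->] := sB u (mem_head _ _).
  rewrite /word rmorph_prod; elim: t => [|i t IHt]; first by rewrite big_nil.
  by rewrite big_cons; apply: SM; [exact: Sg|exact: IHt].
- split=> [|a]; first exact: normal_classes_lin_indep.
  suff [s [c [_ sN e]]] : in_span Nbar a by exists s, c.
  rewrite -[a]pi_algK; have [s [c [_ sB ->]]] := in_span_words (repr a).
  rewrite raddf_sum; elim: s sB => [|u s IH] sB.
    by rewrite big_nil; apply: in_span0.
  rewrite big_cons; apply: in_spanD; last first.
    by apply: IH => v vs; apply: sB; rewrite inE vs orbT.
  have /wordsP[t ->] := sB u (mem_head _ _).
  have [d [alpha e]] := word_straighten t.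
  rewrite -[X in in_span _ X]/(pi _) pi_alg_scale e alg_scaleA.
  have [->|m0] := eqVneq (monomial Xbar alpha) 0.
    by rewrite /alg_scale mulr0; apply: in_span0.
  exact/in_span_scale/monomial_class.
- move=> a [u [/wordsP[s ->] _] <-]; exists [seq (i, 1%N) | i <- s].
  by rewrite big_map /word rmorph_prod; apply: eq_bigr => i _; rewrite expr1.
- move=> _ _ [u [/wordsP[s ->] _] <-] [v [/wordsP[t ->] _] <-].
  rewrite -(rmorphM pi) -word_cat; have [c [alpha e]] := word_straighten (s ++ t).
  have [|p0] := eqVneq (pi (word K (s ++ t))) 0; [by left|right].
  exists c, (monomial Xbar alpha); split=> //.
  + by apply: contra_neq p0 => c0; rewrite e c0 alg_scale0.
  + apply: monomial_class; apply: contra_neq p0 => m0.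
    by rewrite e m0 /alg_scale mulr0.
Qed.

Variable lt : rel {ffun 'I_n -> nat}.
Hypothesis lt_strict : strict_total lt.
Hypothesis lt_least : forall S, S !=set0 -> has_least lt S.
Local Notation prec_I := (@induced_order K R I N n X lt).

Lemma induced_orderE alpha beta : N (monomial X alpha) -> N (monomial X beta) ->
  prec_I (monomial Xbar alpha) (monomial Xbar beta) = lt alpha beta.
Proof.
move=> Na Nb; apply/asboolP/idP => [[a [b [Na' Nb' ea eb ab]]]|ab].
  by rewrite (monomial_inj Na Na' ea) (monomial_inj Nb Nb' eb).
by exists alpha, beta.
Qed.

Lemma induced_order_well_ordering : well_ordering Nbar prec_I.
Proof.
have [irr tra tot] := lt_strict; split.
- by move=> u /normal_classP[a Na ->]; rewrite induced_orderE ?irr.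
- move=> u v w /normal_classP[a Na ->] /normal_classP[b Nb ->].
  by move=> /normal_classP[c Nc ->]; rewrite !induced_orderE //; apply: tra.
- move=> u v /normal_classP[a Na ->] /normal_classP[b Nb ->].
  have [->|/tot/orP[ab|ba]] := eqVneq a b; first by constructor 2.
    by constructor 1; rewrite induced_orderE.
  by constructor 3; rewrite induced_orderE.
move=> S SN [x Sx].
(* The minimum is taken over exponents of normal monomials only, where classes and exponents
   correspond. *)
pose S' := [set a | N (monomial X a) /\ S (monomial Xbar a)].
have [|m [Nm Sm] mmin] := @lt_least S'.
  by have [a Na e] := normal_classP (SN _ Sx); exists a; split; rewrite -?e.
exists (monomial Xbar m) => // y Sy.
have [a Na ey] := normal_classP (SN _ Sy); rewrite ey => am.
rewrite induced_orderE //; apply: mmin; first by split; rewrite -?ey.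
by apply/eqP => e; apply: am; rewrite e.
Qed.

(* [F] stands for the multiplication by a fixed element of the basis, on one
   side or on both, and [phi] for the corresponding map on exponents. *)
Variables (F : A -> A) (phi : {ffun 'I_n -> nat} -> {ffun 'I_n -> nat}).
Hypothesis FE : forall alpha,
  exists c, F (monomial Xbar alpha) = c *k: monomial Xbar (phi alpha).

(** Nonvanishing makes both the scalar and the new monomial nonzero, so the latter is normal and is
    the leading monomial. *)
Lemma LM_monomial_map alpha : F (monomial Xbar alpha) != 0 ->
  N (monomial X (phi alpha)) /\
  LM Nbar prec_I (F (monomial Xbar alpha)) = monomial Xbar (phi alpha).
Proof.
have [c ->] := FE alpha => F0.
have m0 : monomial Xbar (phi alpha) != 0.
  by apply: contra_neq F0 => ->; rewrite /alg_scale mulr0.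
split; first exact: monomial_normal.
apply: LM_scale; last by apply: contra_neq F0 => ->; rewrite alg_scale0.
- exact: normal_classes_lin_indep.
- exact: induced_order_well_ordering.
- exact: monomial_class.
Qed.

Lemma LM_map_monotone w u : (forall a b, lt a b -> lt (phi a) (phi b)) ->
  Nbar w -> Nbar u -> prec_I w u ->
  ~ is_scalar (LM Nbar prec_I (F w)) -> ~ is_scalar (LM Nbar prec_I (F u)) ->
  prec_I (LM Nbar prec_I (F w)) (LM Nbar prec_I (F u)).
Proof.
move=> mono /normal_classP[a Na ->] /normal_classP[b Nb ->].
rewrite induced_orderE // => ab nsa nsb.
(* [LM] of 0 is 0, which is a scalar. *)
have nz x : ~ is_scalar (LM Nbar prec_I x) -> x != 0.
  by apply: contra_notN => /eqP->; rewrite /LM eqxx; exists 0; rewrite raddf0.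
have [Na' ->] := LM_monomial_map (nz _ nsa).
have [Nb' ->] := LM_monomial_map (nz _ nsb).
by rewrite induced_orderE //; apply: mono.
Qed.

Lemma LM_map_increasing w u : (forall a, lt a (phi a)) ->
  Nbar w -> Nbar u -> u = LM Nbar prec_I (F w) -> prec_I w u.
Proof.
move=> incr /normal_classP[a Na ->] Nu e.
(* As a basis element [u] is nonzero, while [LM] of 0 is 0. *)
have Fa0 : F (monomial Xbar a) != 0.
  have := lin_indep_neq0 normal_classes_lin_indep Nu.
  by apply: contra_neq => F0; rewrite e F0 /LM eqxx.
have [Na' e'] := LM_monomial_map Fa0.
by rewrite e e' induced_orderE.
Qed.

End NormalMonomials.

(** * Admissible systems from insertions *)

Section GroebnerTheory.
Variables (K : fieldType) (n : nat) (prec : rel (free_alg K n)).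
Variable I : idealType (free_alg K n).
Hypothesis wo : well_ordering (words K n) prec.
Variable l : {perm 'I_n}.
Local Notation R := (free_alg K n).
Local Notation B := (words K n).
Local Notation A := (quot_alg I).
Local Notation pi := (pi_alg I).
Local Notation N := (normal_monomials B prec I).
Local Notation Nbar := [set pi u | u in N].
Local Notation X := (fun i => gen K (l i) : R).
Local Notation Xbar := (fun i => pi (X i)).
Implicit Types (alpha : {ffun 'I_n -> nat}) (s : seq 'I_n).

Section Insertions.
Hypothesis monomial_normal :
  forall alpha, monomial Xbar alpha != 0 -> N (monomial X alpha).
Variable ins : 'I_n -> {ffun 'I_n -> nat} -> {ffun 'I_n -> nat}.

Definition left_insertion : Prop := forall i alpha,
  exists c, Xbar i * monomial Xbar alpha = c *k: monomial Xbar (ins i alpha).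

Definition right_insertion : Prop := forall i alpha,
  exists c, monomial Xbar alpha * Xbar i = c *k: monomial Xbar (ins i alpha).

(** [ins] is indexed by places in the sequence of the permuted generators, so the letter [k] enters
    through its place under [l^-1]. The last letter of the word acts first. *)
Definition left_insert_word s alpha :=
  foldr (fun k => ins ((l^-1)%g k)) alpha s.

Definition right_insert_word s alpha :=
  foldl (fun a k => ins ((l^-1)%g k) a) alpha s.

Lemma left_insert_wordE : left_insertion -> forall s alpha,
  exists c, pi (word K s) * monomial Xbar alpha =
            c *k: monomial Xbar (left_insert_word s alpha).
Proof.
move=> insE s alpha; elim: s => [|k s [c IH]].
  by exists 1; rewrite /word big_nil rmorph1 mul1r; apply/esym/alg_scale1.
rewrite -cat1s word_cat word1 rmorphM -mulrA IH alg_scaleAr.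
have [d] := insE ((l^-1)%g k) (left_insert_word s alpha); rewrite permKV => ->.
by exists (c * d); apply: alg_scaleA.
Qed.

Lemma right_insert_wordE : right_insertion -> forall s alpha,
  exists c, monomial Xbar alpha * pi (word K s) =
            c *k: monomial Xbar (right_insert_word s alpha).
Proof.
move=> insE s alpha; elim/last_ind: s => [|s k [c IH]].
  by exists 1; rewrite /word big_nil rmorph1 mulr1; apply/esym/alg_scale1.
rewrite -cats1 word_cat word1 rmorphM mulrA IH alg_scaleAl.
have [d] := insE ((l^-1)%g k) (right_insert_word s alpha); rewrite permKV => ->.
by exists (c * d); rewrite /right_insert_word foldl_cat; apply: alg_scaleA.
Qed.

Lemma monomial0 : monomial Xbar [ffun=> 0%N] = 1.
Proof. by rewrite /monomial big1 // => i _; rewrite ffunE expr0. Qed.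

(** The letters of the word are inserted into the monomial 1. *)
Lemma left_straighten : left_insertion ->
  forall s, exists c alpha, pi (word K s) = c *k: monomial Xbar alpha.
Proof.
move=> insE s; have [c e] := left_insert_wordE insE s [ffun=> 0%N].
by exists c, (left_insert_word s [ffun=> 0%N]); rewrite -e monomial0 mulr1.
Qed.

Lemma right_straighten : right_insertion ->
  forall s, exists c alpha, pi (word K s) = c *k: monomial Xbar alpha.
Proof.
move=> insE s; have [c e] := right_insert_wordE insE s [ffun=> 0%N].
by exists c, (right_insert_word s [ffun=> 0%N]); rewrite -e monomial0 mul1r.
Qed.

Variable lt : rel {ffun 'I_n -> nat}.
Hypothesis lt_strict : strict_total lt.
Hypothesis lt_least : forall S, S !=set0 -> has_least lt S.
Hypothesis ins_monotone : forall i a b, lt a b -> lt (ins i a) (ins i b).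
Hypothesis ins_increasing : forall i a, lt a (ins i a).
Local Notation prec_I := (@induced_order K R I N n X lt).

Lemma left_insert_word_monotone s a b :
  lt a b -> lt (left_insert_word s a) (left_insert_word s b).
Proof. by move=> ab; elim: s => //= k s; apply: ins_monotone. Qed.

Lemma right_insert_word_monotone s a b :
  lt a b -> lt (right_insert_word s a) (right_insert_word s b).
Proof. by elim: s a b => //= k s IH a b ab; apply/IH/ins_monotone. Qed.

Lemma left_insert_word_increasing s a :
  s != [::] -> lt a (left_insert_word s a).
Proof.
have [_ tra _] := lt_strict; elim: s => //= k s IH _.
case: (eqVneq s [::]) => [->|/IH as_]; first exact: ins_increasing.
exact: tra as_ (ins_increasing _ _).
Qed.

Lemma right_insert_word_increasing s a :
  s != [::] -> lt a (right_insert_word s a).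
Proof.
have [_ tra _] := lt_strict; elim: s a => //= k s IH a _.
case: (eqVneq s [::]) => [->|/IH as_]; first exact: ins_increasing.
exact: tra (ins_increasing _ _) (as_ _).
Qed.

Lemma normal_class_word v : Nbar v -> exists s, v = pi (word K s).
Proof. by move=> [u [/wordsP[s ->] _] <-]; exists s. Qed.

Lemma pi_word_neq1 s : pi (word K s) != 1 -> s != [::].
Proof. by apply: contra_neq => ->; rewrite /word big_nil rmorph1. Qed.

(** Every basis element is the class of a word, and multiplication by it acts on exponents letter by
    letter; monotonicity and strict increase of [ins] thus pass to all basis elements. *)
Lemma left_insertion_groebner : left_insertion ->
  left_groebner_theory (fun i => pi (gen K i)) Nbar prec_I.
Proof.
move=> insE; have straighten := left_straighten insE; split.
  exact: (normal_classes_basis wo monomial_normal straighten).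
split.
- exact: (induced_order_well_ordering wo monomial_normal straighten).
- move=> w u v Nw Nu /normal_class_word[s ->].
  apply: (LM_map_monotone (F := fun a => pi (word K s) * a)
           wo monomial_normal straighten lt_strict lt_least
           (left_insert_wordE insE s) _ Nw Nu) => a b.
  exact: left_insert_word_monotone.
move=> w u Nw Nu [v [/normal_class_word[s ->] /pi_word_neq1 s0]].
apply: (LM_map_increasing (F := fun a => pi (word K s) * a)
         wo monomial_normal straighten lt_strict lt_least
         (left_insert_wordE insE s) _ Nw Nu) => a.
exact: left_insert_word_increasing.
Qed.

Lemma right_insertion_groebner : right_insertion ->
  right_groebner_theory (fun i => pi (gen K i)) Nbar prec_I.
Proof.
move=> insE; have straighten := right_straighten insE; split.
  exact: (normal_classes_basis wo monomial_normal straighten).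
split.
- exact: (induced_order_well_ordering wo monomial_normal straighten).
- move=> w u v Nw Nu /normal_class_word[s ->].
  apply: (LM_map_monotone (F := fun a => a * pi (word K s))
           wo monomial_normal straighten lt_strict lt_least
           (right_insert_wordE insE s) _ Nw Nu) => a b.
  exact: right_insert_word_monotone.
move=> w u Nw Nu [v [/normal_class_word[s ->] /pi_word_neq1 s0]].
apply: (LM_map_increasing (F := fun a => a * pi (word K s))
         wo monomial_normal straighten lt_strict lt_least
         (right_insert_wordE insE s) _ Nw Nu) => a.
exact: right_insert_word_increasing.
Qed.

Lemma two_sided_insertion_groebner : left_insertion -> right_insertion ->
  two_sided_groebner_theory (fun i => pi (gen K i)) Nbar prec_I.
Proof.
move=> insE insE'; have straighten := left_straighten insE; split.
  exact: (normal_classes_basis wo monomial_normal straighten).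
have two_sided_insertE s t alpha : exists c,
    pi (word K s) * monomial Xbar alpha * pi (word K t) =
    c *k: monomial Xbar (right_insert_word t (left_insert_word s alpha)).
  have [c e] := left_insert_wordE insE s alpha.
  have [d e'] := right_insert_wordE insE' t (left_insert_word s alpha).
  by exists (c * d); apply: alg_scale_mulr e e'.
split.
- exact: (induced_order_well_ordering wo monomial_normal straighten).
- move=> w u v v' Nw Nu /normal_class_word[s ->] /normal_class_word[t ->].
  apply: (LM_map_monotone (F := fun a => pi (word K s) * a * pi (word K t))
           wo monomial_normal straighten lt_strict lt_least
           (two_sided_insertE s t) _ Nw Nu) => a b ab.
  exact/right_insert_word_monotone/left_insert_word_monotone.
move=> w u Nw Nu [v [v' [/normal_class_word[s ->] /normal_class_word[t ->] st]]].
apply: (LM_map_increasing (F := fun a => pi (word K s) * a * pi (word K t))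
         wo monomial_normal straighten lt_strict lt_least
         (two_sided_insertE s t) _ Nw Nu) => a.
have [_ tra _] := lt_strict.
(* At least one of the two words is nonempty, and an empty one leaves exponents unchanged. *)
have [s0|/left_insert_word_increasing as_] := eqVneq s [::].
  rewrite s0; apply: right_insert_word_increasing.
  by case: st => /pi_word_neq1 //; rewrite s0 eqxx.
have [->|/right_insert_word_increasing at_] := eqVneq t [::]; first exact: as_.
exact: tra (as_ a) (at_ _).
Qed.

End Insertions.
End GroebnerTheory.

(** * Insertions obtained from the swap relations *)

Section SwapRelations.
Variables (K : fieldType) (n : nat) (I : idealType (free_alg K n)).
Variable l : {perm 'I_n}.
Local Notation Xbar := (fun i => pi_alg I (gen K (l i))).
Implicit Type p : 'I_n -> 'I_n -> 'I_n.

Definition ord_lt : rel 'I_n := fun i j => (i < j)%N.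
Definition ord_gt : rel 'I_n := fun i j => (j < i)%N.

Definition left_ins p q a := expD (exp1 (carry ord_lt p a (enum 'I_n) q)) a.
(** In the mirror image the moving letter is the smaller one and travels to the left, so the
    ordering, the list of blocks and the arguments of [p] are all reversed. *)
Definition right_ins p q a :=
  expD (exp1 (carry ord_gt (fun j i => p i j) a (rev (enum 'I_n)) q)) a.

Lemma ord_lt_irr : irreflexive ord_lt. Proof. by move=> i; apply: ltnn. Qed.
Lemma ord_gt_irr : irreflexive ord_gt. Proof. by move=> i; apply: ltnn. Qed.

Lemma ord_lt_trans : transitive ord_lt.
Proof. by move=> j i k; apply: ltn_trans. Qed.

Lemma ord_gt_trans : transitive ord_gt.
Proof. by move=> j i k ij jk; apply: ltn_trans ij. Qed.

Lemma enum_ord_sorted : sorted ord_lt (enum 'I_n).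
Proof. by have := iota_ltn_sorted 0 n; rewrite -val_enum_ord sorted_map. Qed.

Lemma enum_ord_pairwise : pairwise ord_lt (enum 'I_n).
Proof. by rewrite -(sorted_pairwise ord_lt_trans) enum_ord_sorted. Qed.

Lemma rev_enum_ord_pairwise : pairwise ord_gt (rev (enum 'I_n)).
Proof.
by rewrite -(sorted_pairwise ord_gt_trans) rev_sorted enum_ord_sorted.
Qed.

Lemma left_insertion_swap p :
  (forall i j : 'I_n, (i < j)%N -> (i < p j i)%N) ->
  (forall i j : 'I_n, (i < j)%N ->
     exists c : K, Xbar j * Xbar i = c *k: (Xbar i * Xbar (p j i))) ->
  left_insertion I l (left_ins p).
Proof.
move=> ltp swap q a; rewrite !monomial_enum.
apply: (insert_prod_left ord_lt_irr ord_lt_trans ltp a q swap enum_ord_pairwise).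
exact: mem_enum.
Qed.

Lemma right_insertion_swap p :
  (forall i j : 'I_n, (i < j)%N -> (p j i < j)%N) ->
  (forall i j : 'I_n, (i < j)%N ->
     exists c : K, Xbar j * Xbar i = c *k: (Xbar (p j i) * Xbar j)) ->
  right_insertion I l (right_ins p).
Proof.
move=> ltp swap q a; rewrite !monomial_enum -[enum _]revK.
have ltp' i j : ord_gt i j -> ord_gt i (p i j) by apply: ltp.
have swap' i j : ord_gt i j ->
    exists c : K, Xbar i * Xbar j = c *k: (Xbar (p i j) * Xbar i) by apply: swap.
apply: (insert_prod_right ord_gt_irr ord_gt_trans ltp' a q swap'
  rev_enum_ord_pairwise) => k.
by rewrite mem_rev mem_enum.
Qed.

End SwapRelations.

(** * The given Groebner basis *)

Section GroebnerBasisMonomials.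
Variables (K : fieldType) (n : nat) (l : {perm 'I_n}).
Variable prec : rel (free_alg K n).
Variables (Omega : set (free_alg K n)) (g : 'I_n -> 'I_n -> free_alg K n).
Variable I : idealType (free_alg K n).
Local Notation R := (free_alg K n).
Local Notation B := (words K n).
Local Notation X := (fun i => gen K (l i) : R).
Local Notation N := (normal_monomials B prec I).
Local Notation G := [set h | exists i j : 'I_n, (i < j)%N /\ h = g j i].
Hypothesis wo : well_ordering B prec.
Hypothesis Omega_words : Omega `<=` B.
Hypothesis LM_g : forall i j : 'I_n, (i < j)%N ->
  LM B prec (g j i) = X j * X i.

Lemma LM_Omega u : Omega u -> LM B prec u = u.
Proof. by move=> /Omega_words; apply: LM_id wo; apply: words_lin_indep. Qed.

Lemma LM_gE (i j : 'I_n) : (i < j)%N -> LM B prec (g j i) = word K [:: l j; l i].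
Proof. by move=> /LM_g ->; rewrite -!word1 -word_cat. Qed.

Lemma LM_words f : f != 0 -> B (LM B prec f).
Proof.
move=> f0; have [s [c [us sB e]]] := in_span_words f.
exact/sB/(LM_mem (@words_lin_indep K n) wo us sB e f0).
Qed.

(** By transitivity of divisibility it suffices to test the leading monomials of the Groebner
    basis. *)
Lemma normal_of_basis u : groebner_basis B prec I (Omega `|` G) -> B u ->
  (forall h, (Omega `|` G) h -> ~ mon_divides B (LM B prec h) u) -> N u.
Proof.
move=> [GI Gdiv] Bu nd; split=> // f If f0 fu.
have [h Gh hf] := Gdiv f If f0; apply: (nd h Gh).
apply: mon_divides_trans hf fu => //; apply: LM_words => //.
by have [] := GI h Gh.
Qed.

Lemma groebner_monomial_normal alpha :
  groebner_basis B prec I (Omega `|` G) ->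
  monomial (fun i => pi_alg I (X i)) alpha != 0 -> N (monomial X alpha).
Proof.
move=> GB m0; apply: normal_of_basis => // [|h].
  by rewrite monomialE; apply: word_words.
case=> [Oh|[i [j [ij ->]]]].
  (* A divisor from [Omega] lies in [I] and would make the monomial vanish in the quotient. *)
  rewrite LM_Omega // => -[c [w [s [c0 _ _ e]]]].
  have Ih : h \in I by have [GI _] := GB; have [] := GI h (or_introl Oh).
  move/eqP: m0; apply; rewrite monomial_pi_alg -(raddf0 (pi_alg I)).
  apply/pi_algP; rewrite subr0 e /alg_scale.
  by apply: two_sided_mull; apply: two_sided_mulr; apply: two_sided_mull.
rewrite LM_gE // monomialE => /mon_divides_word[a [b e]].
by have := exponent_word_sorted e; rewrite leqNgt ij.
Qed.

(** Minimality is what keeps the generator normal: otherwise a word of [Omega] of length at most one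
    divides it, hence also divides the leading word of [g j i], and [g j i] could be removed from
    the basis. *)
Lemma groebner_gen_normal (k i j : 'I_n) :
  minimal_groebner_basis B prec I (Omega `|` G) ->
  (i < j)%N -> k = i \/ k = j -> N (gen K (l k)).
Proof.
move=> [GB min] ij kij; apply: normal_of_basis => // [|h].
  by rewrite -word1; apply: word_words.
rewrite -word1; case=> [Oh|[i' [j' [ij' ->]]]]; last first.
  rewrite LM_gE // => /mon_divides_word[a [b /(congr1 size)]].
  by rewrite !size_cat /= addnCA !addSn.
move=> hk; have := hk; rewrite LM_Omega //.
have /wordsP[s es] := Omega_words Oh; rewrite es => /mon_divides_word[a [b sk]].
have sz : (size s <= 1)%N.
  by have := congr1 size sk; rewrite !size_cat /= addnCA => ->; apply: leq_addr.
apply: (min ((Omega `|` G) `\ g j i)); first split.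
- by move=> x [].
- move=> sub; have [|_] := sub (g j i); first by right; exists i, j.
  exact.
have [GI Gdiv] := GB; split=> [x [/GI //]|f If f0].
have [x Gx xf] := Gdiv f If f0.
have [ex|nx] := pselect (x = g j i); last by exists x.
have hg : mon_divides B (LM B prec h) (LM B prec (g j i)).
  apply: (mon_divides_trans _ _ _ hk).
  - by rewrite LM_Omega //; apply: Omega_words.
  - exact: word_words.
  - by rewrite LM_gE //; apply: word_words.
  rewrite (LM_gE ij); case: kij => ->.
    exact: (mon_divides_cat K [:: l j] [:: l i] [::]).
  exact: (mon_divides_cat K [::] [:: l j] [:: l i]).
rewrite ex in xf; exists h; last first.
  apply: (mon_divides_trans _ _ _ hg xf).
  - by rewrite LM_Omega //; apply: Omega_words.
  - by rewrite LM_gE //; apply: word_words.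
  - exact: LM_words.
split; first by left.
(* [h] survives the removal: its leading word has at most one letter, that of [g j i] has two. *)
move=> eg; have := LM_Omega Oh; rewrite {1}eg LM_gE // es => /word_inj es'.
by rewrite -es' in sz.
Qed.

End GroebnerBasisMonomials.

Lemma monomial_exp1 (K : fieldType) (A : pzAlgType K) n (a : 'I_n -> A) k :
  monomial a (exp1 k) = a k.
Proof.
rewrite /monomial -[RHS]expr1 -(big_pred1_eq *%R k (fun i => a i ^+ 1)) big_mkcond.
by apply: eq_bigr => i _; rewrite ffunE /=; case: eqP => // ->; rewrite expr1.
Qed.

(** * Compatibility of insertions with the orderings *)

Section InsertionMonotone.
Variable n : nat.
Implicit Types (a b : {ffun 'I_n -> nat}) (p : 'I_n -> 'I_n -> 'I_n).

(** The situation of case (iii): the letter keeps its index, and insertion is translation by a unit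
    vector. *)
Lemma carry_id (r : rel 'I_n) a ks q : carry r (fun j _ => j) a ks q = q.
Proof.
elim: ks q => //= k ks IH q; have -> : iter (a k) id q = q by elim: (a k).
by rewrite if_same.
Qed.

Lemma left_ins_lex p q a b : (forall i j : 'I_n, (i < j)%N -> (i < p j i)%N) ->
  lex a b -> lex (left_ins p q a) (left_ins p q b).
Proof.
move=> ltp /lexP ab; apply/lexP.
exact: (first_diff_insert (@ord_lt_irr n) (@ord_lt_trans n) ltp q
  (enum_ord_pairwise n) (mem_enum _)).
Qed.

Lemma revlexP a b : revlex a b <-> first_diff (@ord_gt n) b a.
Proof.
split=> [/lexP[i]|[i [bai e]]]; rewrite ?ffunE.
  move=> [bai e]; exists (rev_ord i); split=> // k ki.
  have := e (rev_ord k); rewrite !ffunE rev_ordK; apply.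
  by rewrite -rev_ord_ltn rev_ordK.
apply/lexP; exists (rev_ord i); rewrite !ffunE rev_ordK; split=> // k ki.
by rewrite !ffunE e // /ord_gt -rev_ord_ltn rev_ordK.
Qed.

Lemma right_ins_revlex p q a b :
  (forall i j : 'I_n, (i < j)%N -> (p j i < j)%N) ->
  revlex a b -> revlex (right_ins p q a) (right_ins p q b).
Proof.
move=> ltp /revlexP ab; apply/revlexP.
have ltp' i j : ord_gt i j -> ord_gt i (p i j) by apply: ltp.
apply: (first_diff_insert (@ord_gt_irr n) (@ord_gt_trans n) ltp' q
  (rev_enum_ord_pairwise n)) => // k.
by rewrite mem_rev mem_enum.
Qed.

(** Since [f] raises every degree by one, it preserves comparisons of degrees and leaves ties to
    [r]. *)
Lemma graded_insert (r : rel {ffun 'I_n -> nat}) f a b :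
  (forall c, mdegree (f c) = (mdegree c).+1) ->
  (forall c d, r c d -> r (f c) (f d)) ->
  graded r a b -> graded r (f a) (f b).
Proof.
move=> fdeg fr; rewrite /graded !fdeg ltnS eqSS.
by case/orP=> [->//|/andP[-> /fr->]]; rewrite orbT.
Qed.

Lemma mdegree_ins k a : mdegree (expD (exp1 k) a) = (mdegree a).+1.
Proof. by rewrite mdegreeD mdegree1. Qed.

End InsertionMonotone.

(** * Derivation of the three cases *)

Theorem corollary2p5 (K : fieldType) (n : nat) (l : {perm 'I_n})
    (prec : rel (free_alg K n))
    (Omega : set (free_alg K n)) (g : 'I_n -> 'I_n -> free_alg K n)
    (G : set (free_alg K n)) (I : idealType (free_alg K n)) :
  let R := free_alg K n in
  let B : set R := words K n in
  let X : 'I_n -> R := fun i => gen K (l i) in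
  let A := quot_alg I in
  let Xbar : 'I_n -> A := fun i => pi_alg I (X i) in
  let N : set R := normal_monomials B prec I in
  let Nbar : set A := [set pi_alg I u | u in N] in
  let prec_I : rel {ffun 'I_n -> nat} -> rel A := induced_order I N X in
  two_sided_monomial_ordering B prec ->
  Omega `<=` B ->
  G = [set h | exists i j : 'I_n, (i < j)%N /\ h = g j i] ->
  (forall i j : 'I_n, (i < j)%N -> LM B prec (g j i) = X j * X i) ->
  I = ideal_gen (Omega `|` G) ->
  minimal_groebner_basis B prec I (Omega `|` G) ->
  [/\ (* (i) *)
      (forall i j : 'I_n, (i < j)%N ->
         exists (p : 'I_n) (lambda : K),
           (i < p)%N /\ g j i = X j * X i - lambda *: (X i * X p)) ->
      (forall alpha, monomial Xbar alpha != 0 -> N (monomial X alpha)) /\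
      (forall lt : rel {ffun 'I_n -> nat},
         lt = @lex n \/ lt = @grlex n ->
         (forall i j : 'I_n, (i < j)%N -> prec_I lt (Xbar j) (Xbar i)) /\
         left_groebner_theory (fun i => pi_alg I (gen K i)) Nbar (prec_I lt)),
      (* (ii) *)
      (forall i j : 'I_n, (i < j)%N ->
         exists (p : 'I_n) (lambda : K),
           (p < j)%N /\ g j i = X j * X i - lambda *: (X p * X j)) ->
      (forall alpha, monomial Xbar alpha != 0 -> N (monomial X alpha)) /\
      ((forall i j : 'I_n, (i < j)%N ->
          prec_I (@grevlex n) (Xbar j) (Xbar i)) /\
       right_groebner_theory (fun i => pi_alg I (gen K i)) Nbar
         (prec_I (@grevlex n))) &
      (* (iii) *)
      (forall i j : 'I_n, (i < j)%N ->
         exists lambda : K,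
           g j i = X j * X i - lambda *: (X i * X j)) ->
      (forall alpha, monomial Xbar alpha != 0 -> N (monomial X alpha)) /\
      (forall lt : rel {ffun 'I_n -> nat},
         [\/ lt = @lex n, lt = @grlex n | lt = @grevlex n] ->
         (forall i j : 'I_n, (i < j)%N -> prec_I lt (Xbar j) (Xbar i)) /\
         two_sided_groebner_theory (fun i => pi_alg I (gen K i)) Nbar
           (prec_I lt))].
Proof.
move=> R B X A Xbar N Nbar prec_I [wo _ _] OB GE LMg _ minG.
have monN alpha : monomial Xbar alpha != 0 -> N (monomial X alpha).
  by have [GB _] := minG; apply: (groebner_monomial_normal wo OB LMg); rewrite -GE.
(* The induced ordering compares only classes of normal monomials, so the generators must be normal
   for their order to make sense. *)
have genN (i j k : 'I_n) : (i < j)%N -> k = i \/ k = j -> N (X k).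
  by apply: (groebner_gen_normal wo OB LMg); rewrite -GE.
have prec_gen (lt : rel {ffun 'I_n -> nat}) :
    (forall i j : 'I_n, (i < j)%N -> lt (exp1 j) (exp1 i)) ->
    forall i j : 'I_n, (i < j)%N -> prec_I lt (Xbar j) (Xbar i).
  move=> lt1 i j ij; apply/asboolP; exists (exp1 j), (exp1 i).
  by rewrite !monomial_exp1; split; rewrite ?lt1 //; apply: (genN i j) => //; auto.
(* Membership of [g j i] in [I] becomes a swap relation between the classes of the generators. *)
have swap (i j k k' : 'I_n) (c : K) : (i < j)%N ->
    g j i = X j * X i - c *: (X k * X k') ->
    Xbar j * Xbar i = c *k: (Xbar k * Xbar k').
  move=> ij e; have [[GI _] _] := minG.
  have [gI _] : g j i \in I /\ g j i != 0.
    by apply: GI; right; rewrite GE; exists i, j.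
  rewrite -!(rmorphM (pi_alg I)) -pi_alg_scale; apply/pi_algP.
  by rewrite free_alg_scaleE -e.
have lex_ok : strict_total (@lex n) /\
    forall S : set {ffun 'I_n -> nat}, S !=set0 -> has_least (@lex n) S.
  by split; [apply: lex_strict_total|apply: lex_has_least].
have grlex_ok : strict_total (@grlex n) /\
    forall S : set {ffun 'I_n -> nat}, S !=set0 -> has_least (@grlex n) S.
  rewrite grlexE; split; first exact/graded_strict_total/lex_strict_total.
  by move=> S S0; apply: graded_has_least => // d S' S'0 _; apply: lex_has_least.
have grevlex_ok : strict_total (@grevlex n) /\
    forall S : set {ffun 'I_n -> nat}, S !=set0 -> has_least (@grevlex n) S.
  rewrite grevlexE; split; first exact/graded_strict_total/revlex_strict_total.
  by move=> S S0; apply: graded_has_least => // d S' S'0; apply: revlex_has_least.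
split.
- move=> gE; split=> // lt ltE.
  (* The index depends on the pair; choice turns it into a function, with the arbitrary value [i]
     when [i < j] fails. *)
  have {gE} /choice[p pP] : forall ji : 'I_n * 'I_n, exists p : 'I_n,
      (ji.2 < ji.1)%N -> (ji.2 < p)%N /\
      exists c : K, Xbar ji.1 * Xbar ji.2 = c *k: (Xbar ji.2 * Xbar p).
    move=> [j i] /=; case: (boolP (i < j)%N) => ij; last by exists i.
    by have [p [c [ip e]]] := gE i j ij; exists p => _; split=> //; exists c; apply: swap e.
  pose p' j i := p (j, i).
  have ltp (i j : 'I_n) : (i < j)%N -> (i < p' j i)%N by move=> /(pP (j, i))[].
  have insE : left_insertion I l (left_ins p').
    by apply: left_insertion_swap => // i j /(pP (j, i))[].
  case: ltE => ->; split.
  + by apply: prec_gen => i j; apply: lex_exp1.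
  + have [st least] := lex_ok.
    apply: left_insertion_groebner insE => //.
      by move=> q a b; apply: left_ins_lex.
    by move=> q a; apply: lex_exp1D.
  + by apply: prec_gen => i j ij; apply/graded_exp1/lex_exp1.
  + have [st least] := grlex_ok.
    apply: left_insertion_groebner insE => //.
      move=> q a b; apply: graded_insert => [c|c d]; first exact: mdegree_ins.
      exact: left_ins_lex.
    by move=> q a; apply: graded_exp1D.
- move=> gE; split=> //.
  have {gE} /choice[p pP] : forall ji : 'I_n * 'I_n, exists p : 'I_n,
      (ji.2 < ji.1)%N -> (p < ji.1)%N /\
      exists c : K, Xbar ji.1 * Xbar ji.2 = c *k: (Xbar p * Xbar ji.1).
    move=> [j i] /=; case: (boolP (i < j)%N) => ij; last by exists i.
    by have [p [c [pj e]]] := gE i j ij; exists p => _; split=> //; exists c; apply: swap e.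
  pose p' j i := p (j, i).
  have ltp (i j : 'I_n) : (i < j)%N -> (p' j i < j)%N by move=> /(pP (j, i))[].
  have insE : right_insertion I l (right_ins p').
    by apply: right_insertion_swap => // i j /(pP (j, i))[].
  have [st least] := grevlex_ok.
  (* In the form [graded revlex], the degree gives strict increase and [revlex] gives monotonicity
     at equal degrees. *)
  rewrite grevlexE in st least *; split.
    by apply: prec_gen => i j ij; apply/graded_exp1/revlex_exp1.
  apply: right_insertion_groebner insE => //.
    move=> q a b; apply: graded_insert => [c|c d]; first exact: mdegree_ins.
    exact: right_ins_revlex.
  by move=> q a; apply: graded_exp1D.
move=> gE; split=> // lt ltE; pose ins (q : 'I_n) := expD (exp1 q).
have swap' (i j : 'I_n) : (i < j)%N ->
    exists c : K, Xbar j * Xbar i = c *k: (Xbar i * Xbar j).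
  by move=> ij; have [c e] := gE i j ij; exists c; apply: swap e.
have insL : left_insertion I l ins.
  have := @left_insertion_swap K n I l (fun j _ => j) _ swap'.
  by move=> h q a; have [//|c] := h _ q a; rewrite /left_ins carry_id; exists c.
have insR : right_insertion I l ins.
  have := @right_insertion_swap K n I l (fun _ i => i) _ swap'.
  by move=> h q a; have [//|c] := h _ q a; rewrite /right_ins carry_id; exists c.
(* On both sides insertion adds a unit vector, so translation invariance gives monotonicity, and
   only properties of the ordering on exponents remain to be checked. *)
have two_sided : strict_total lt ->
    (forall S : set {ffun 'I_n -> nat}, S !=set0 -> has_least lt S) ->
    translation_invariant lt -> (forall q a, lt a (expD (exp1 q) a)) ->
    (forall i j : 'I_n, (i < j)%N -> lt (exp1 j) (exp1 i)) ->
    (forall i j : 'I_n, (i < j)%N -> prec_I lt (Xbar j) (Xbar i)) /\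
    two_sided_groebner_theory (fun i => pi_alg I (gen K i)) Nbar (prec_I lt).
  move=> st least trans incr lt1; split; first exact: prec_gen.
  by apply: two_sided_insertion_groebner insL insR => // q a b; apply: trans.
case: ltE => ltE; rewrite ltE in two_sided *; apply: two_sided.
- by have [] := lex_ok.
- by have [] := lex_ok.
- exact: lexD.
- by move=> q a; apply: lex_exp1D.
- exact: lex_exp1.
- by have [] := grlex_ok.
- by have [] := grlex_ok.
- exact/gradedD/lexD.
- by move=> q a; apply: graded_exp1D.
- by move=> i j ij; apply/graded_exp1/lex_exp1.
- by have [] := grevlex_ok.
- by have [] := grevlex_ok.
- by rewrite grevlexE; apply/gradedD/revlexD.
- by move=> q a; rewrite grevlexE; apply: graded_exp1D.
- by move=> i j ij; rewrite grevlexE; apply/graded_exp1/revlex_exp1.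
Qed.
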